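(* Let $K$ be a field, let $d\ge1$, and let $\Delta$ be a strongly-connected $d$-dimensional simplicial complex on $n$ vertices. Then $\Delta$ is unit-interval if and only if there is a labeling of the vertices of $\Delta$ by $1,\dots,n$ such that, with respect to this same labeling, $\Delta$ is traceable (i.e. $\{i,i+1,\dots,i+d\}\in\Delta$ for all $i=1,\dots,n-d$) and the minors $[a_0a_1\ldots a_d]$, with $\{a_0<\dots<a_d\}$ ranging over the $d$-faces of $\Delta$, form a Gröbner basis of the determinantal facet ideal $J_\Delta$ with respect to any diagonal term order.
   Context: A pure $d$-dimensional simplicial complex is strongly-connected if its dual graph is connected; the dual graph has the facets as nodes, and two facets are joined by an arc iff their intersection has cardinality $d$. Strongly-connected complexes are by convention pure. A labeling of a simplicial complex with $n$ vertices is a bijection of its vertex set with $\{1,\dots,n\}$. A pure $d$-dimensional complex $\Delta$ with $n$ vertices is unit-interval if there is a labeling such that for every $d$-face $\{a_0<a_1<\dots<a_d\}$ of $\Delta$, every $(d+1)$-element subset of $\{a_0,a_0+1,\dots,a_d\}$ is a face of $\Delta$. Let $S=K[x_{ij}: 0\le i\le d,\ 1\le j\le n]$ and let $X=(x_{ij})$ be the $(d+1)\times n$ matrix of variables (rows indexed $0,\dots,d$, columns $1,\dots,n$). For $0\le a_0<\dots<a_r\le d$ and $1\le b_0<\dots<b_r\le n$, $[a_0\ldots a_r|b_0\ldots b_r]$ is the minor of $X$ with rows $a_0,\dots,a_r$ and columns $b_0,\dots,b_r$; when $r=d$ it is written $[b_0\ldots b_d]$. For a labeled complex $\Delta$, the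 determinantal facet ideal is $J_\Delta=([a_0\ldots a_d]: \{a_0<\dots<a_d\}\in\Delta)\subset S$. A term order on $S$ is diagonal if the initial term of every minor $[a_0\ldots a_r|b_0\ldots b_r]$ is the diagonal product $x_{a_0b_0}x_{a_1b_1}\cdots x_{a_rb_r}$. *)

(* Defs.v *)
(* Rows are indexed by 'I_d.+1 and vertex labels / columns by 'I_n, so the
   label j : 'I_n stands for the vertex j+1 of {1, ..., n}. *)
From HB Require Import structures.
From mathcomp Require Import all_boot all_order all_algebra.
From mathcomp Require Import mpoly.

Set Implicit Arguments.
Unset Strict Implicit.
Unset Printing Implicit Defensive.

Import GRing.Theory.
Local Open Scope ring_scope.

Section Complexes.
Variable V : finType.
Implicit Types (Delta : {set {set V}}) (F G : {set V}) (d : nat).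

(* All of V is required to be used, so that #|V| is the number of vertices. *)
Definition simplicial_complex Delta : Prop :=
  [/\ set0 \in Delta,
      forall v : V, [set v] \in Delta
    & forall F G, F \in Delta -> G \subset F -> G \in Delta].

Definition facets Delta : {set {set V}} :=
  [set F | maxset (fun G => G \in Delta) F].

Definition has_dim Delta d : Prop := (\max_(F in Delta) #|F|)%N = d.+1.

Definition pure Delta d : Prop := forall F, F \in facets Delta -> #|F| = d.+1.

Definition dual_graph Delta d : rel {set V} :=
  fun F G => [&& F \in facets Delta, G \in facets Delta & #|F :&: G| == d].

Definition strongly_connected Delta d : Prop :=
  pure Delta d /\
  {in facets Delta &, forall F G, connect (dual_graph Delta d) F G}.

Definition relabel n (lab : V -> 'I_n) Delta : {set {set 'I_n}} :=
  [set lab @: F | F : {set V} in Delta].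

End Complexes.

Definition increasing r n (a : 'I_r -> 'I_n) : Prop :=
  forall i j : 'I_r, (i < j)%N -> (a i < a j)%N.

Section LabeledComplexes.
Variables (n d : nat) (Gamma : {set {set 'I_n}}).

(* a enumerates the vertices a_0 < ... < a_d of a d-face. *)
Definition dface (a : 'I_d.+1 -> 'I_n) : Prop :=
  increasing a /\ [set a i | i : 'I_d.+1] \in Gamma.

Definition unit_interval_labeled : Prop :=
  forall a, dface a ->
  forall G : {set 'I_n}, #|G| = d.+1 ->
    G \subset [set k : 'I_n | (a ord0 <= k <= a ord_max)%N] -> G \in Gamma.

Definition traceable_labeled : Prop :=
  forall i : nat, (i + d < n)%N ->
    [set k : 'I_n | (i <= k <= i + d)%N] \in Gamma.

End LabeledComplexes.

Definition unit_interval (V : finType) (n d : nat) (Delta : {set {set V}}) :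
    Prop :=
  exists2 lab : V -> 'I_n,
    bijective lab & unit_interval_labeled d (relabel lab Delta).

Definition ideal_gen (R : comNzRingType) (G : R -> Prop) (f : R) : Prop :=
  exists2 s : seq (R * R),
    forall p, p \in s -> G p.2 & f = \sum_(p <- s) p.1 * p.2.

Section Groebner.
Variables (K : fieldType) (m : nat).
Implicit Types (le : rel 'X_{1..m}) (f g : {mpoly K[m]}).

Definition term_order le : Prop :=
  [/\ [/\ reflexive le, antisymmetric le, transitive le & total le],
      forall u, le 0%MM u
    & forall u v w, le u v -> le (u + w)%MM (v + w)%MM].

(* The le-largest monomial of f: the default 0%MM is the le-smallest monomial
   when le is a term order, so it is harmless if f != 0. *)
Definition initial_monomial le f : 'X_{1..m} :=
  \big[(fun u v => if le u v then v else u)/0%MM]_(u <- msupp f) u.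

Definition initial_term le f : {mpoly K[m]} :=
  f@_(initial_monomial le f) *: 'X_[initial_monomial le f].

(* initial_term le 0 = 0, so there is no need to exclude f = 0. *)
Definition initial_ideal le (G : {mpoly K[m]} -> Prop) :
    {mpoly K[m]} -> Prop :=
  ideal_gen (fun t => exists2 f, G f & t = initial_term le f).

Definition groebner_basis le (G J : {mpoly K[m]} -> Prop) : Prop :=
  (forall g, G g -> J g) /\
  (forall f, initial_ideal le J f <-> initial_ideal le G f).

End Groebner.

Section DeterminantalFacetIdeal.
Variables (K : fieldType) (d n : nat).

Definition x_ (i : 'I_d.+1) (j : 'I_n) : {mpoly K[d.+1 * n]} :=
  'X_(mxvec_index i j).

Definition minor r (a : 'I_r -> 'I_d.+1) (b : 'I_r -> 'I_n) :
    {mpoly K[d.+1 * n]} :=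
  \det (mxsub a b (\matrix_(i < d.+1, j < n) x_ i j)).

Definition diagonal (le : rel 'X_{1..d.+1 * n}) : Prop :=
  forall r (a : 'I_r.+1 -> 'I_d.+1) (b : 'I_r.+1 -> 'I_n),
    increasing a -> increasing b ->
    initial_term le (minor a b) = \prod_(i < r.+1) x_ (a i) (b i).

Definition facet_minors (Gamma : {set {set 'I_n}}) (f : {mpoly K[d.+1 * n]}) :
    Prop :=
  exists2 a : 'I_d.+1 -> 'I_n, dface Gamma a & f = minor id a.

Definition det_facet_ideal (Gamma : {set {set 'I_n}}) :
    {mpoly K[d.+1 * n]} -> Prop :=
  ideal_gen (facet_minors Gamma).

End DeterminantalFacetIdeal.

(* Main.v *)
(* Write X^{mon a} for the diagonal monomial of the minor [a].

   Unit-interval implies Groebner: fix a common multiple u of two diagonal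
   monomials. That the rescaled difference of [a] and [b] is a combination of
   multiples of minors with smaller diagonal terms is a transitive relation
   between the faces whose diagonal monomial divides u. Within a full interval
   one can go from a to b through min(a, b), changing one position at a time,
   and for a single change the relation follows from expanding a determinant
   with a repeated row. Two faces in different intervals either share a
   position, and then the mixed face (b_0, ..., b_i, a_{i+1}, ..., a_d) lies in
   both intervals, or have coprime diagonal monomials. Traceability comes from
   the dual graph: facets adjacent in it cannot lie on different sides of
   i, ..., i + d.

   Groebner implies unit-interval: a diagonal order for which exchanging rows k
   and k + 1 is cheaper than any other permutation makes the initial term of an
   S-polynomial explicit, so that two faces which agree at k (or at k + 1) force
   a third face. Starting from the consecutive faces, this fills the interval of
   every face, by induction on its length. *)
Require Import Defs.
From HB Require Import structures.
From mathcomp Require Import all_boot all_order all_algebra all_fingroup.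
From mathcomp Require Import mpoly zify ring.

Set Implicit Arguments.
Unset Strict Implicit.
Unset Printing Implicit Defensive.

Import GRing.Theory.

(** * Term orders and minors *)

Section Initial.
Local Open Scope ring_scope.
Variables (K : fieldType) (m : nat) (le : rel 'X_{1..m}).
Hypothesis tole : term_order le.
Implicit Types (f g : {mpoly K[m]}) (u v w : 'X_{1..m}).

Let le_refl : reflexive le. Proof. by case: tole => -[]. Qed.
Let le_anti : antisymmetric le. Proof. by case: tole => -[]. Qed.
Let le_trans : transitive le. Proof. by case: tole => -[]. Qed.
Let le_total : total le. Proof. by case: tole => -[]. Qed.

Definition strict u v := le u v && (u != v).

Lemma strictN u v : strict u v = ~~ le v u.
Proof.
rewrite /strict; case: (boolP (le v u)) => vu; last first.
  have /orP[uv|/(negP vu)//] := le_total u v.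
  by rewrite uv /=; apply: contraNneq vu => ->; apply: le_refl.
case: (boolP (le u v)) => //= uv.
by apply/negbTE; rewrite negbK; apply/eqP/le_anti; rewrite uv.
Qed.

Lemma strict_le_trans u v w : strict u v -> le v w -> strict u w.
Proof.
rewrite !strictN => nvu vw; apply: contra nvu => wu; exact: le_trans vw wu.
Qed.

Lemma le_strict_trans u v w : le u v -> strict v w -> strict u w.
Proof.
rewrite !strictN => uv; apply: contra => wu; exact: le_trans wu uv.
Qed.

Lemma strict_add u v w : strict u v -> strict (u + w)%MM (v + w)%MM.
Proof.
case/andP=> uv nuv; rewrite /strict eqm_add2r nuv andbT.
by case: tole => _ _; apply.
Qed.

Let mx u v := if le u v then v else u.

Let mx_le u v : le u (mx u v) && le v (mx u v).
Proof.
rewrite /mx; case: ifPn; first by move=> ->; rewrite le_refl.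
by rewrite -strictN le_refl /strict => /andP[->].
Qed.

Lemma le_initial f u : u \in msupp f -> le u (initial_monomial le f).
Proof.
rewrite /initial_monomial; elim: (msupp f) => //= v s IH.
rewrite big_cons inE => /predU1P[->|/IH us].
  by have /andP[] := mx_le v (\big[mx/0%MM]_(w <- s) w).
apply: le_trans us _.
by have /andP[] := mx_le v (\big[mx/0%MM]_(w <- s) w).
Qed.

Lemma initial_msupp f : f != 0 -> initial_monomial le f \in msupp f.
Proof.
rewrite -msupp_eq0 /initial_monomial; elim: (msupp f) => //= v s IH _.
rewrite big_cons; case: ifPn => [|_]; last by rewrite mem_head.
case: s IH => [_|w s IH _]; last by rewrite inE IH ?orbT.
rewrite big_nil inE => v0.
by apply/eqP/le_anti; rewrite v0 andbT; case: tole => _ -> _.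
Qed.

Lemma initial_unique f w : w \in msupp f ->
  (forall v, v \in msupp f -> le v w) -> initial_monomial le f = w.
Proof.
move=> wf maxw; apply: le_anti; rewrite le_initial // andbT.
by apply: maxw; apply: initial_msupp; apply: contraTneq wf => ->; rewrite msupp0.
Qed.

(** Comparing coefficients at [u] reads a leading monomial and a leading coefficient off an equation
    such as the one in [diagonal]. *)
Lemma initial_termX f u :
  initial_term le f = 'X_[u] -> initial_monomial le f = u /\ f@_u = 1.
Proof.
rewrite /initial_term => /(congr1 (fun p => p@_u)).
rewrite mcoeffZ !mcoeffX eqxx; case: eqP => [<- /=|_ /=].
  by rewrite mulr1.
by rewrite mulr0 => /eqP; rewrite eq_sym oner_eq0.
Qed.

End Initial.

Lemma mxvec_index_eq m n (i i' : 'I_m) (j j' : 'I_n) :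
  (mxvec_index i j == mxvec_index i' j') = (i == i') && (j == j').
Proof.
by rewrite (inj_eq (@cast_ord_inj _ _ _)) (inj_eq enum_rank_inj) xpair_eqE.
Qed.

Lemma increasing_inj r n (a : 'I_r -> 'I_n) : increasing a -> injective a.
Proof.
by move=> inc i j eq_a; case: (ltngtP i j) => [/inc|/inc|/val_inj] //;
  rewrite eq_a ltnn.
Qed.

Section Monomials.
Local Open Scope ring_scope.
Variables (d n : nat).

(** Exponent of one term of a minor. The rows [al] are kept general because [diagonal] speaks of
    minors of every size. *)
Definition place_mon r (al : 'I_r -> 'I_d.+1) (c : 'I_r -> 'I_n) :
    'X_{1..d.+1 * n} :=
  (\sum_(i < r) U_(mxvec_index (al i) (c i)))%MM.

Definition mon (c : 'I_d.+1 -> 'I_n) := place_mon id c.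

Lemma place_monE r (al : 'I_r -> 'I_d.+1) (c : 'I_r -> 'I_n) i j :
  injective al -> place_mon al c (mxvec_index (al i) j) = (c i == j).
Proof.
move=> al_inj; rewrite mnm_sumE (bigD1 i) //= mnm1E mxvec_index_eq eqxx /=.
rewrite big1 ?addn0 // => k ki; rewrite mnm1E mxvec_index_eq.
by rewrite (inj_eq al_inj) (negPf ki).
Qed.

Lemma place_mon_inj r (al : 'I_r -> 'I_d.+1) (c c' : 'I_r -> 'I_n) :
  injective al -> place_mon al c = place_mon al c' -> c =1 c'.
Proof.
move=> al_inj eqc i; apply/eqP; have := place_monE c' i (c i) al_inj.
by rewrite -eqc place_monE // eqxx eq_sym; case: eqP.
Qed.

Lemma monE c i j : mon c (mxvec_index i j) = (c i == j).
Proof. by rewrite (@place_monE _ id c i j) //; exact: inj_id. Qed.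

Lemma mon_inj c c' : mon c = mon c' -> c =1 c'.
Proof. by apply: place_mon_inj; exact: inj_id. Qed.

Lemma eq_mon c c' : c =1 c' -> mon c = mon c'.
Proof. by move=> eqc; apply: eq_bigr => i _; rewrite eqc. Qed.

Lemma mdeg_mon c : mdeg (mon c) = d.+1.
Proof.
rewrite mdeg_sum (eq_bigr (fun=> 1%N)) => [|i _]; last by rewrite mdeg1.
by rewrite sum1_card card_ord.
Qed.

Lemma mnm_mxvecP (u v : 'X_{1..d.+1 * n}) :
  (forall i j, u (mxvec_index i j) = v (mxvec_index i j)) -> u = v.
Proof. by move=> h; apply/mnmP => k; case/mxvec_indexP: k. Qed.

Lemma lep_mxvecP (u v : 'X_{1..d.+1 * n}) :
  reflect (forall i j, (u (mxvec_index i j) <= v (mxvec_index i j))%N)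
    (u <= v)%MM.
Proof.
apply: (iffP mnm_lepP) => [h i j|h k]; first exact: h.
by case/mxvec_indexP: k.
Qed.

Lemma mon_lepP c (u : 'X_{1..d.+1 * n}) :
  reflect (forall i, (0 < u (mxvec_index i (c i)))%N) (mon c <= u)%MM.
Proof.
apply: (iffP (lep_mxvecP _ _)) => [h i|h i j].
  by apply: leq_trans (h i (c i)); rewrite monE eqxx.
by rewrite monE; case: eqP => // <-.
Qed.

End Monomials.

Section Minors.
Local Open Scope ring_scope.
Variables (K : fieldType) (d n : nat).

Lemma minorE r (al : 'I_r -> 'I_d.+1) (c : 'I_r -> 'I_n) :
  minor K al c =
  \sum_(s : 'S_r) (-1) ^+ s *: 'X_[place_mon al (c \o s)] :> {mpoly K[d.+1 * n]}.
Proof.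
rewrite /minor /determinant; apply: eq_bigr => s _.
rewrite -mprodXE -mul_mpolyC rmorphXn rmorphN rmorph1; congr (_ * _).
by apply: eq_bigr => i _; rewrite !mxE.
Qed.

Lemma eq_minor r (al : 'I_r -> 'I_d.+1) (c c' : 'I_r -> 'I_n) :
  c =1 c' -> minor K al c = minor K al c'.
Proof.
by move=> eqc; congr (\det _); apply/matrixP=> i j; rewrite !mxE eqc.
Qed.

Lemma minor_msupp r (al : 'I_r -> 'I_d.+1) (c : 'I_r -> 'I_n) u :
  u \in msupp (minor K al c) -> exists s : 'S_r, u = place_mon al (c \o s).
Proof.
rewrite minorE => /msupp_sum_le /flatten_mapP[s _ /msuppZ_le].
by rewrite msuppX inE => /eqP ->; exists s.
Qed.

Lemma minor_coeff r (al : 'I_r -> 'I_d.+1) (c : 'I_r -> 'I_n)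
    (s : 'S_r) :
  injective al -> injective c ->
  (minor K al c)@_(place_mon al (c \o s)) = (-1) ^+ s.
Proof.
move=> al_inj c_inj; rewrite minorE raddf_sum (bigD1 s) //= big1 => [|t ts].
  by rewrite addr0 mcoeffZ mcoeffX eqxx mulr1.
rewrite mcoeffZ mcoeffX; case: eqP => [/place_mon_inj eq_st|_]; rewrite ?mulr0 //.
by case/eqP: ts; apply/permP => i; apply: c_inj; apply: eq_st.
Qed.

(* The zero determinant with row k repeated, expanded along the copy. *)
Lemma minor_relation k (e : 'I_d.+2 -> 'I_n) :
  \sum_(s < d.+2) (-1) ^+ s *: ('X_(mxvec_index k (e s))
     * minor K id (e \o lift s)) = 0 :> {mpoly K[d.+1 * n]}.
Proof.
pose M := \matrix_(i < d.+2, s < d.+2)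
  x_ K (if unlift ord0 i is Some i' then i' else k) (e s).
have: \det M = 0.
  apply: (@determinant_alternate _ _ _ ord0 (lift ord0 k)) => // s.
  by rewrite !mxE unlift_none liftK.
rewrite (expand_det_row _ ord0) => det0; rewrite -[RHS]det0.
apply: eq_bigr => s _.
rewrite mxE unlift_none /cofactor add0n -mul_mpolyC rmorphXn rmorphN rmorph1.
rewrite mulrCA; congr (_ * (_ * \det _)).
by apply/matrixP => i j; rewrite !mxE liftK.
Qed.

End Minors.

(** * Reduction of S-pairs for unit-interval complexes *)

Section LSpan.
Local Open Scope ring_scope.
Variables (R : nzRingType) (M : lmodType R).
Implicit Types (P Q : M -> Prop).

(** Coefficients are scalars only: monomial factors stay inside the generators, where [P] can bound
    them. *)
Inductive lspan P : M -> Prop :=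
| lspan0 : lspan P 0
| lspanD c p f : P p -> lspan P f -> lspan P (c *: p + f).

Lemma lspan_add P f g : lspan P f -> lspan P g -> lspan P (f + g).
Proof.
elim=> [|c p f' Pp _ IH] sg; first by rewrite add0r.
by rewrite -addrA; apply: lspanD => //; apply: IH.
Qed.

Lemma lspan_scale P c f : lspan P f -> lspan P (c *: f).
Proof.
elim=> [|c' p f' Pp _ IH]; first by rewrite scaler0; apply: lspan0.
by rewrite scalerDr scalerA; apply: lspanD.
Qed.

Lemma lspan_opp P f : lspan P f -> lspan P (- f).
Proof. by rewrite -scaleN1r; apply: lspan_scale. Qed.

Lemma lspan_gen P f : P f -> lspan P f.
Proof.
move=> Pf; rewrite -[f]addr0 -[f]scale1r.
by apply: lspanD; last exact: lspan0.
Qed.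

Lemma lspan_sum P (I : Type) (r : seq I) (S : pred I) (F : I -> M) :
  (forall i, S i -> lspan P (F i)) -> lspan P (\sum_(i <- r | S i) F i).
Proof. by move=> spF; apply: big_ind => //; [exact: lspan0 | exact: lspan_add]. Qed.

Lemma lspan_bind P Q f : (forall p, P p -> lspan Q p) -> lspan P f -> lspan Q f.
Proof.
move=> PQ; elim=> [|c p f' Pp _ IH]; first exact: lspan0.
by apply: lspan_add => //; apply: lspan_scale; apply: PQ.
Qed.

End LSpan.

Section Increasing.
Variables (d n : nat).
Implicit Types (a b c : 'I_d.+1 -> 'I_n) (k : 'I_d.+1).

Lemma eq_increasing r (a b : 'I_r -> 'I_n) :
  a =1 b -> increasing a -> increasing b.
Proof. by move=> eqab inc i j ij; rewrite -!eqab; apply: inc. Qed.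

Lemma ltn_bump h i j : i < j -> bump h i < bump h j.
Proof. by rewrite /bump; lia. Qed.

Lemma ltn_bumpI h i j : bump h i < bump h j -> i < j.
Proof. by rewrite /bump; lia. Qed.

Lemma ltn_bumpl h i : bump h i < h -> i < h.
Proof. by rewrite /bump; lia. Qed.

Lemma ltn_bumpr h i : h < bump h i -> h <= i.
Proof. by rewrite /bump; lia. Qed.

Lemma increasing_lift r (e : 'I_r.+1 -> 'I_n) s :
  increasing e -> increasing (e \o lift s).
Proof. by move=> inc i j ij; apply: inc; apply: ltn_bump. Qed.

Lemma increasing_le r (a : 'I_r -> 'I_n) (i j : 'I_r) :
  increasing a -> i <= j -> a i <= a j.
Proof.
move=> inc; rewrite leq_eqVlt => /predU1P[/val_inj -> //|/inc]; exact: ltnW.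
Qed.

Lemma increasing_min a i : increasing a -> a ord0 <= a i.
Proof. by move=> inc; apply: increasing_le. Qed.

Lemma increasing_max a i : increasing a -> a i <= a ord_max.
Proof. by move=> inc; apply: increasing_le => //; apply: leq_ord. Qed.

Lemma increasing_add r (a : 'I_r -> 'I_n) (i j : 'I_r) :
  increasing a -> i <= j -> a i + (j - i) <= a j.
Proof.
move=> inc; case: j => j /= ltj; elim: j ltj => [|j IH] ltj ij.
  have -> : i = Ordinal ltj by apply: val_inj => /=; lia.
  by rewrite /= subnn addn0.
have [ij'|ji] := leqP i j; last first.
  have -> : i = Ordinal ltj by apply: val_inj => /=; lia.
  by rewrite /= subnn addn0.
have := IH (ltnW ltj) ij'; have := inc (Ordinal (ltnW ltj)) (Ordinal ltj).
rewrite /= ltnSn => /(_ isT); lia.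
Qed.

Lemma eq_dface Gamma a b : a =1 b -> dface Gamma a -> dface Gamma b.
Proof.
move=> eqab [inc aG]; split; first exact: eq_increasing inc.
by rewrite -(eq_imset _ eqab).
Qed.

Lemma card_increasing r (a : 'I_r -> 'I_n) :
  increasing a -> #|[set a i | i : 'I_r]| = r.
Proof. by move=> inc; rewrite card_imset ?card_ord //; apply: increasing_inj. Qed.

Definition insert k (p : 'I_n) a : 'I_d.+2 -> 'I_n :=
  fun s => if unlift (lift ord0 k) s is Some i then a i else p.

Local Notation wide := (widen_ord (leqnSn d.+1)).

Lemma lift_wide k : lift (wide k) k = lift ord0 k.
Proof. by apply: val_inj; rewrite /= /bump; lia. Qed.

Lemma lift_lift0 k : lift (lift ord0 k) k = wide k.
Proof. by apply: val_inj; rewrite /= /bump; lia. Qed.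

Lemma lift_wideN k i : i != k -> lift (wide k) i = lift (lift ord0 k) i.
Proof. by rewrite -val_eqE => /= ik; apply: val_inj; rewrite /= /bump; lia. Qed.

Lemma insert_lift k p a i : insert k p a (lift (lift ord0 k) i) = a i.
Proof. by rewrite /insert liftK. Qed.

Lemma insert_lift0 k p a : insert k p a (lift ord0 k) = p.
Proof. by rewrite /insert unlift_none. Qed.

Lemma insert_wide k p a i :
  insert k p a (lift (wide k) i) = if i == k then p else a i.
Proof.
case: eqP => [->|/eqP ik]; first by rewrite lift_wide insert_lift0.
by rewrite lift_wideN // insert_lift.
Qed.

Lemma insert_increasing k (p : 'I_n) a : increasing a -> a k < p ->
  (forall i : 'I_d.+1, k < i -> p < a i) -> increasing (insert k p a).
Proof.
move=> inc kp pk s t; rewrite /insert.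
case: unliftP => [i|] ->; case: unliftP => [j|] -> //; last by rewrite ltnn.
- by move=> /ltn_bumpI ij; apply: inc.
- move=> /ltn_bumpl ik; apply: leq_ltn_trans kp.
  by apply: increasing_le => //; rewrite -ltnS.
- by move=> /ltn_bumpr kj; apply: pk.
Qed.

Lemma unit_interval_dface (Gamma : {set {set 'I_n}}) a c :
  unit_interval_labeled d Gamma -> dface Gamma a -> increasing c ->
  a ord0 <= c ord0 -> c ord_max <= a ord_max -> dface Gamma c.
Proof.
move=> ui fa inc a0 am; split=> //; apply: ui fa _ _ _.
  exact: card_increasing.
apply/subsetP => _ /imsetP[i _ ->]; rewrite inE.
have := increasing_min i inc; have := increasing_max i inc.
by move=> ? ?; apply/andP; split; lia.
Qed.

End Increasing.

(** * S-pairs of minors over a fixed common multiple *)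

Section Buchberger.
Local Open Scope ring_scope.
Variables (K : fieldType) (d n : nat) (Gamma : {set {set 'I_n}}).
Variable le : rel 'X_{1..d.+1 * n}.
Hypothesis tole : term_order le.
Hypothesis mon_lt : forall (a : 'I_d.+1 -> 'I_n) (s : 'S_d.+1),
  increasing a -> s != 1%g -> strict le (mon (a \o s)) (mon a).

Implicit Types (a b c : 'I_d.+1 -> 'I_n) (u v w : 'X_{1..d.+1 * n}).
Implicit Types (f g : {mpoly K[d.+1 * n]}) (Q : 'X_{1..d.+1 * n} -> Prop).

Local Notation det a := (minor K id a).
Local Notation wide := (widen_ord (leqnSn d.+1)).

(** [Q] constrains the diagonal monomial of the product, so that [rep Q] is a standard
    representation whose summands have their leading monomials in [Q]. *)
Definition multiple Q f := exists m a,
  [/\ dface Gamma a, Q (m + mon a)%MM & f = 'X_[m] * det a].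

Definition rep Q := lspan (multiple Q).

Lemma rep_mulX Q (Q' : 'X_{1..d.+1 * n} -> Prop) w f :
  (forall v, Q v -> Q' (w + v)%MM) -> rep Q f -> rep Q' ('X_[w] * f).
Proof.
move=> QQ'; elim=> [|c p f' [m [a [fa Qa ->]]] _ IH].
  by rewrite mulr0; apply: lspan0.
rewrite mulrDr -scalerAr mulrA -mpolyXD; apply: lspanD => //.
by exists (w + m)%MM, a; split; rewrite -?addmA //; apply: QQ'.
Qed.

Lemma rep_gen Q m a : dface Gamma a -> Q (m + mon a)%MM -> rep Q ('X_[m] * det a).
Proof. by move=> fa Qa; apply: lspan_gen; exists m, a. Qed.

(** The degree is recorded for the sake of termination: only finitely many monomials have bounded
    degree. *)
Definition below u v := strict le v u /\ mdeg v = mdeg u.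

Lemma below_add w u v : below u v -> below (w + u)%MM (w + v)%MM.
Proof.
by case=> ltvu eqd; split; rewrite ?mdegD ?eqd // ![(w + _)%MM]addmC strict_add.
Qed.

(* The S-pair of a and b, rescaled to a common multiple u of the diagonal
   monomials, reduces to lower terms. Fixing u, rather than taking the lcm,
   makes the relation transitive. *)
Definition sim u a b :=
  rep (below u) ('X_[u - mon a] * det a - 'X_[u - mon b] * det b).

Lemma sim_refl u a : sim u a a.
Proof. by rewrite /sim subrr; apply: lspan0. Qed.

Lemma sim_sym u a b : sim u a b -> sim u b a.
Proof. by move=> ab; rewrite /sim -opprB; apply: lspan_opp. Qed.

Lemma sim_trans u b a c : sim u a b -> sim u b c -> sim u a c.
Proof. by move=> ab /(lspan_add ab); rewrite addrA subrK. Qed.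

Lemma eq_sim u a a' b b' : a =1 a' -> b =1 b' -> sim u a b -> sim u a' b'.
Proof.
by move=> ea eb; rewrite /sim (eq_mon ea) (eq_mon eb) !(eq_minor _ _ ea)
  (eq_minor _ _ eb).
Qed.

(** In the left-hand product row [k] carries both [e s] and [e h]. Letting these two trade roles
    shows the leading monomial of term [s] of [minor_relation] as a permuted monomial of term
    [h]. *)
Lemma mon_lift_exchange (e : 'I_d.+2 -> 'I_n) (k : 'I_d.+1)
    (s : 'I_d.+2) :
  let h := lift s k in
  exists2 t : 'S_d.+1, (t k == k -> s = lift h k) &
    (U_(mxvec_index k (e s)) + mon (e \o lift s) =
     U_(mxvec_index k (e h)) + mon ((e \o lift h) \o t))%MM.
Proof.
move=> h; pose tau i := if i == k then s else lift s i.
have tau_h i : h != tau i.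
  rewrite /tau; case: (i =P k) => [_|/eqP ik]; first by rewrite eq_sym neq_lift.
  by rewrite (inj_eq lift_inj) eq_sym.
have tau_inj : injective tau.
  move=> i j; rewrite /tau; case: eqP => [->|_]; case: eqP => [->|_] //.
  - by move/eqP; rewrite (negPf (neq_lift _ _)).
  - by move/esym/eqP; rewrite (negPf (neq_lift _ _)).
  - exact: lift_inj.
pose sg i := odflt k (unlift h (tau i)).
have sgE i : lift h (sg i) = tau i.
  by rewrite /sg; case: unliftP (tau_h i) => [j ->|->]; rewrite ?eqxx.
have sg_inj : injective sg.
  by move=> i j /(congr1 (lift h)); rewrite !sgE; apply: tau_inj.
exists (perm sg_inj).
  by rewrite permE => /eqP sgk; rewrite -{1}sgk sgE /tau eqxx.
rewrite /mon /place_mon (bigD1 k) // [in RHS](bigD1 k) //= permE sgE /tau eqxx.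
rewrite addmA [in RHS]addmA; congr (_ + _)%MM; first exact: addmC.
by apply: eq_bigr => i ik; rewrite permE sgE /tau (negPf ik).
Qed.

(** In [minor_relation] for row [k], the terms dropping index k and index k + 1 share their leading
    monomial and all others are strictly lower; solving for these two terms gives the reduction of
    their S-pair. *)
Lemma sim_adjacent u (e : 'I_d.+2 -> 'I_n) (k : 'I_d.+1) :
  increasing e -> (forall s, dface Gamma (e \o lift s)) ->
  (mon (e \o lift (wide k)) <= u)%MM ->
  (mon (e \o lift (lift ord0 k)) <= u)%MM ->
  sim u (e \o lift (wide k)) (e \o lift (lift ord0 k)).
Proof.
set h0 := wide k; set h1 := lift ord0 k => inc_e face_e le0 le1.
pose key s := (U_(mxvec_index k (e s)) + mon (e \o lift s))%MM.
have h01 : h0 != h1 by rewrite -val_eqE /= /bump; lia.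
have e01 : e h0 != e h1 by rewrite (inj_eq (increasing_inj inc_e)).
have eq_key : key h0 = key h1.
  rewrite /key /mon /place_mon (bigD1 k) // [in RHS](bigD1 k) //=.
  rewrite lift_wide lift_lift0 addmA [in RHS]addmA -/h0 -/h1.
  congr (_ + _)%MM; first exact: addmC.
  by apply: eq_bigr => i ik; rewrite lift_wideN.
(* The two faces differ only in row [k], by the distinct variables of [e h0] and [e h1], so the
   common key is the lcm of their monomials. *)
have key_u : (key h0 <= u)%MM.
  apply/lep_mxvecP => i j; rewrite mnmDE mnm1E mxvec_index_eq monE /=.
  have [<-|ki] := eqVneq k i; last first.
    by have /lep_mxvecP/(_ i j) := le0; rewrite monE.
  rewrite lift_wide -/h1; have /lep_mxvecP/(_ k j) := le1.
  have /lep_mxvecP/(_ k j) := le0; rewrite !monE /= lift_wide lift_lift0.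
  rewrite -/h0 -/h1; have [eh0|//] := eqVneq (e h0) j.
  by rewrite -eh0 eq_sym (negPf e01).
have key_lt s : s != h0 -> s != h1 -> strict le (key s) (key h0).
  move=> s0 s1; have [t tk] := mon_lift_exchange e k s; rewrite -/(key s) => ->.
  (* Row [k] of the minor without [e s] holds index k or k + 1 of [e], so term [s] is always
     compared with one of the two leading terms. *)
  have hP : lift s k = h0 \/ lift s k = h1.
    have [sk|ks] := leqP s k; [right|left]; apply: val_inj; rewrite /= /bump; lia.
  have -> : key h0 = key (lift s k) by case: hP => ->.
  rewrite /key ![(U_(_) + _)%MM]addmC; apply: strict_add => //; apply: mon_lt.
    exact: increasing_lift.
  apply: contra_neq (s0) => t1; have := tk; rewrite t1 perm1 eqxx => /(_ isT).
  case: hP => ->; last by rewrite lift_lift0.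
  by rewrite lift_wide => /eqP; rewrite (negPf s1).
have diff_mon h : h = h0 \/ h = h1 ->
  'X_[u - mon (e \o lift h)] * det (e \o lift h) =
  'X_[u - key h0] * ('X_(mxvec_index k (e h)) * det (e \o lift h)).
  move=> hP; rewrite mulrA -mpolyXD; congr ('X_[_] * _).
  have -> : key h0 = key h by case: hP => ->.
  have : (key h <= u)%MM by case: hP => ->; rewrite -?eq_key.
  move=> /lep_mxvecP lekey; apply: mnm_mxvecP => i j.
  by move: (lekey i j); rewrite !(mnmBE, mnmDE); lia.
rewrite /sim !diff_mon; [|by right|by left].
rewrite -mulrBr -(submK key_u); apply: (@rep_mulX (below (key h0))).
  by move=> v; rewrite addmK; apply: below_add.
have := minor_relation K k e; rewrite (bigD1 h0) //= (bigD1 h1) 1?eq_sym //=.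
set rest := (X in _ + (_ + X) = 0).
(* The consecutive indices carry opposite signs, so the two leading terms appear as a difference. *)
rewrite /bump leq0n add1n exprS mulN1r scaleNr addrA -scalerBr.
move=> /(congr1 (fun f => (-1) ^+ k *: f)).
rewrite scaler0 scalerDr scalerA -exprMn mulrNN mulr1 expr1n scale1r.
move/eqP; rewrite addr_eq0 => /eqP ->; apply/lspan_opp/lspan_scale/lspan_sum.
move=> s /andP[s0 s1]; apply/lspan_scale/rep_gen; first exact: face_e.
by split; [exact: key_lt|rewrite !mdegD !mdeg1 !mdeg_mon].
Qed.


Section FullInterval.
Variables lo hi : nat.
Hypothesis full : forall c, increasing c ->
  (lo <= c ord0)%N -> (c ord_max <= hi)%N -> dface Gamma c.

(** Induction on the number of positions where [a] and [b] differ. Raising [a] to [b] at the last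
    such position keeps it increasing, since the two agree afterwards, and is an adjacent move. *)
Lemma sim_pointwise_le u a b : increasing a -> increasing b ->
  (lo <= a ord0)%N -> (b ord_max <= hi)%N -> (forall i, a i <= b i)%N ->
  (mon a <= u)%MM -> (mon b <= u)%MM -> sim u a b.
Proof.
have [N] := ubnP #|[set i | a i != b i]|; elim: N => // N IH in a *.
move=> ltN inca incb loa bhi ab au bu.
have [i0 ab0|eqab] := pickP (fun i => a i != b i); last first.
  apply: (@eq_sim u a a a b) (sim_refl u a) => // i.
  by have /negbFE/eqP := eqab i.
have [k abk maxk] := @arg_maxnP _ i0 (fun i => a i != b i) val ab0.
have eqab (i : 'I_d.+1) : (k < i)%N -> a i = b i.
  by move=> ki; apply/eqP; apply: contraTT ki => /maxk; rewrite -leqNgt.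
pose c i := if i == k then b i else a i.
have ltk : (a k < b k)%N by rewrite ltn_neqAle ab andbT.
pose e := insert k (b k) a.
have inc_e : increasing e.
  by apply: insert_increasing => // i ki; rewrite eqab //; apply: incb.
have e_c i : (e \o lift (wide k)) i = c i.
  by rewrite /= /e insert_wide /c; case: eqP => // ->.
have e_a i : (e \o lift (lift ord0 k)) i = a i by rewrite /= /e insert_lift.
have incc : increasing c := eq_increasing e_c (increasing_lift _ inc_e).
have cb i : (c i <= b i)%N by rewrite /c; case: eqP.
have cu : (mon c <= u)%MM.
  apply/mon_lepP => i; rewrite /c.
  by case: eqP => _; [exact: (mon_lepP _ _ bu) | exact: (mon_lepP _ _ au)].
apply: (@sim_trans _ c); last first.
  apply: IH => //; last by rewrite /c; case: eqP => // _; apply: leq_trans (ab _).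
  apply: leq_trans (ltN : _ <= N)%N; apply: proper_card; apply/properP; split.
    by apply/subsetP => i; rewrite !inE /c; case: (i =P k); rewrite ?eqxx.
  by exists k; rewrite !inE // /c eqxx eqxx.
apply: sim_sym; apply: (eq_sim e_c e_a); apply: sim_adjacent => //.
- move=> s; apply: full; first exact: increasing_lift.
    rewrite /= /e /insert; case: unlift => [i|].
      exact: leq_trans (increasing_min i inca).
    by apply: leq_trans (ab k); apply: leq_trans (increasing_min k inca).
  rewrite /= /e /insert; case: unlift => [i|].
    exact: leq_trans (ab i) (leq_trans (increasing_max i incb) bhi).
  exact: leq_trans (increasing_max k incb) bhi.
- by rewrite (eq_mon e_c).
- by rewrite (eq_mon e_a).
Qed.

Lemma sim_full u a b : increasing a -> increasing b ->
  (lo <= a ord0)%N -> (a ord_max <= hi)%N ->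
  (lo <= b ord0)%N -> (b ord_max <= hi)%N ->
  (mon a <= u)%MM -> (mon b <= u)%MM -> sim u a b.
Proof.
move=> inca incb loa ahi lob bhi au bu.
pose c i := if (a i <= b i)%N then a i else b i.
have incc : increasing c.
  move=> i j ij; have lta := inca _ _ ij; have ltb := incb _ _ ij; rewrite /c.
  by case: (leqP (a i) (b i)) => abi; case: (leqP (a j) (b j)) => abj; lia.
have ca i : (c i <= a i)%N by rewrite /c; case: (leqP (a _) (b _)) => ?; lia.
have cb i : (c i <= b i)%N by rewrite /c; case: (leqP (a _) (b _)) => ?; lia.
have loc : (lo <= c ord0)%N by rewrite /c; case: (leqP (a _) (b _)) => ?; lia.
have cu : (mon c <= u)%MM.
  apply/mon_lepP => i; rewrite /c.
  by case: (leqP (a i) (b i)) => _;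
    [exact: (mon_lepP _ _ au) | exact: (mon_lepP _ _ bu)].
by apply: (@sim_trans _ c); [apply: sim_sym|]; apply: sim_pointwise_le.
Qed.

End FullInterval.

Lemma minor_tail a : det a = 'X_[mon a] +
  \sum_(s : 'S_d.+1 | s != 1%g) (-1) ^+ s *: 'X_[mon (a \o s)].
Proof.
rewrite minorE (bigD1 1%g) //= odd_perm1 expr0 scale1r; congr ('X_[_] + _).
by apply: eq_mon => i /=; rewrite perm1.
Qed.

(** Buchberger's criterion for coprime leading monomials. *)
Lemma sim_coprime u a b : dface Gamma a -> dface Gamma b ->
  (forall i, a i != b i) -> (mon a <= u)%MM -> (mon b <= u)%MM -> sim u a b.
Proof.
move=> fa fb ab au bu; have [[inca _] [incb _]] := (fa, fb).
have abu : (mon a + mon b <= u)%MM.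
  move/lep_mxvecP: au => au; move/lep_mxvecP: bu => bu.
  apply/lep_mxvecP => i j; rewrite mnmDE; move: (au i j) (bu i j).
  by rewrite !monE; case: eqP => [<-|//]; rewrite eq_sym (negPf (ab i)) addn0.
set w := (u - (mon a + mon b))%MM.
have wE : u = (w + (mon a + mon b))%MM by rewrite submK.
have ua : (u - mon a = w + mon b)%MM.
  by rewrite {1}wE [(mon a + _)%MM]addmC addmA addmK.
have ub : (u - mon b = w + mon a)%MM by rewrite {1}wE addmA addmK.
rewrite /sim ua ub !mpolyXD -!mulrA -mulrBr.
apply: (@rep_mulX (below (mon a + mon b)%MM)).
  by move=> v; rewrite wE; apply: below_add.
(* Each monomial is the minor minus its tail; the product of the two full minors cancels, leaving
   tails times minors. *)
rewrite (_ : _ - _ =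
    (det a - 'X_[mon a]) * det b - (det b - 'X_[mon b]) * det a); last by ring.
have tail_rep c c' : dface Gamma c -> dface Gamma c' ->
    rep (below (mon c + mon c')%MM) ((det c - 'X_[mon c]) * det c').
  move=> fc fc'; rewrite minor_tail addrC addKr mulr_suml.
  apply: lspan_sum => s s1; rewrite -scalerAl; apply: lspan_scale.
  apply: rep_gen => //; split; last by rewrite !mdegD !mdeg_mon.
  by apply: strict_add => //; apply: mon_lt => //; case: fc.
apply: lspan_add; first exact: tail_rep.
by apply: lspan_opp; rewrite addmC; apply: tail_rep.
Qed.

Hypothesis ui : unit_interval_labeled d Gamma.

Lemma sim_dface u a b : dface Gamma a -> dface Gamma b ->
  (mon a <= u)%MM -> (mon b <= u)%MM -> sim u a b.
Proof.
wlog ab0 : a b / (a ord0 <= b ord0)%N => [hwlog|] fa fb au bu.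
  by have [/hwlog|/ltnW/hwlog ba] := leqP (a ord0) (b ord0); last apply/sim_sym; auto.
have [[inca _] [incb _]] := (fa, fb).
have full_a c := @unit_interval_dface d n Gamma a c ui fa.
have full_b c := @unit_interval_dface d n Gamma b c ui fb.
have [bam|abm] := leqP (b ord_max) (a ord_max).
  exact: (sim_full full_a).
have [i /eqP abi|ab] := pickP (fun i => a i == b i); last first.
  by apply: sim_coprime => // i; rewrite ab.
(* The switch at [i] keeps [c] increasing because [a i = b i]; [c] starts at [b ord0] and ends no
   later than [a ord_max], hence lies in both intervals. *)
pose c (j : 'I_d.+1) := if (j <= i)%N then b j else a j.
have incc : increasing c.
  move=> j l jl; rewrite /c; have := inca _ _ jl; have := incb _ _ jl.
  case: (leqP j i) => ji; case: (leqP l i) => li // _ _; last lia.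
  by apply: leq_ltn_trans (increasing_le incb ji) _; rewrite -abi; apply: inca.
have c0 : c ord0 = b ord0 by rewrite /c leq0n.
have cm : (c ord_max <= a ord_max)%N.
  rewrite /c; case: ifP => // mi.
  have im : i = ord_max by apply: val_inj; apply/eqP; rewrite eqn_leq leq_ord.
  by rewrite -im abi.
have cu : (mon c <= u)%MM.
  apply/mon_lepP => j; rewrite /c.
  by case: (leqP j i) => _;
    [exact: (mon_lepP _ _ bu) | exact: (mon_lepP _ _ au)].
apply: (@sim_trans _ c).
  by apply: (sim_full full_a) => //; rewrite c0.
apply: (sim_full full_b); rewrite ?c0 //.
exact: leq_trans cm (ltnW abm).
Qed.

End Buchberger.

Section IdealGen.
Local Open Scope ring_scope.
Variable R : comNzRingType.
Implicit Types (P Q : R -> Prop) (f g : R).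

Lemma ideal_gen_gen P f : P f -> ideal_gen P f.
Proof.
move=> Pf; exists [:: (1, f)]; first by move=> p; rewrite inE => /eqP ->.
by rewrite big_seq1 mul1r.
Qed.

Lemma ideal_gen_mul P g f : ideal_gen P f -> ideal_gen P (g * f).
Proof.
case=> s sP ->; exists [seq (g * p.1, p.2) | p <- s].
  by move=> _ /mapP[p ps ->]; apply: (sP p).
by rewrite big_map mulr_sumr; apply: eq_bigr => p _; rewrite mulrA.
Qed.

Lemma ideal_gen_add P f g : ideal_gen P f -> ideal_gen P g -> ideal_gen P (f + g).
Proof.
case=> s sP -> [t tP ->]; exists (s ++ t); last by rewrite big_cat.
by move=> p; rewrite mem_cat => /orP[/sP|/tP].
Qed.

Lemma ideal_gen0 P : ideal_gen P 0.
Proof. by exists [::]; rewrite ?big_nil. Qed.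

Lemma ideal_gen_bind P Q f :
  (forall g, P g -> ideal_gen Q g) -> ideal_gen P f -> ideal_gen Q f.
Proof.
move=> PQ [s sP ->]; rewrite big_seq; apply: big_ind.
- exact: ideal_gen0.
- exact: ideal_gen_add.
- by move=> p ps; apply/ideal_gen_mul/PQ/sP.
Qed.

End IdealGen.

(** * From reductions of S-pairs to initial monomials of the ideal *)

Section Groebner.
Local Open Scope ring_scope.
Variables (K : fieldType) (d n : nat) (Gamma : {set {set 'I_n}}).
Variable le : rel 'X_{1..d.+1 * n}.
Hypothesis tole : term_order le.
Hypothesis diag : diagonal K le.
Hypothesis ui : unit_interval_labeled d Gamma.

Implicit Types (a b c : 'I_d.+1 -> 'I_n) (u v w : 'X_{1..d.+1 * n}).
Implicit Types (f g : {mpoly K[d.+1 * n]}) (Q : 'X_{1..d.+1 * n} -> Prop).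

Local Notation det a := (minor K id a).
Local Notation rep := (@rep K d n Gamma).

Lemma initial_term_det a : increasing a -> initial_term le (det a) = 'X_[mon a].
Proof. by move=> inc; rewrite diag // mprodXE. Qed.

Lemma det_coeff a : increasing a -> (det a)@_(mon a) = 1.
Proof. by move/initial_term_det/initial_termX => []. Qed.

Lemma det_le a v : increasing a -> v \in msupp (det a) -> le v (mon a).
Proof.
by move=> /initial_term_det/initial_termX[<- _] vs; apply: le_initial.
Qed.

Lemma mon_lt_diag a (s : 'S_d.+1) :
  increasing a -> s != 1%g -> strict le (mon (a \o s)) (mon a).
Proof.
move=> inc s1; apply/andP; split.
  apply: det_le => //; rewrite mcoeff_msupp (minor_coeff K s) ?signr_eq0 //.
  exact: increasing_inj.
apply: contraNneq s1 => /mon_inj eqs; apply/eqP/permP => i.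
by rewrite perm1; apply: (increasing_inj inc); apply: eqs.
Qed.

Let lt_deg D u v := strict le v u /\ (mdeg v <= D)%N.
Let le_deg D u v := le v u /\ (mdeg v <= D)%N.

Lemma rep_weaken Q (Q' : 'X_{1..d.+1 * n} -> Prop) f :
  (forall v, Q v -> Q' v) -> rep Q f -> rep Q' f.
Proof.
move=> QQ'; apply: lspan_bind => _ [m [a [fa Qa ->]]].
by apply: rep_gen => //; apply: QQ'.
Qed.

Lemma rep_msupp Q f v : rep Q f -> v \in msupp f -> exists2 u, Q u & le v u.
Proof.
elim=> [|c p f' [m [a [fa Qa ->]]] _ IH]; first by rewrite msupp0.
move/msuppD_le; rewrite mem_cat => /orP[/msuppZ_le|/IH //].
rewrite mulrC (perm_mem (msuppMX _ _)) => /mapP[w wa ->].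
exists (m + mon a)%MM => //; rewrite ![(m + _)%MM]addmC.
by case: tole => _ _; apply; apply: det_le => //; case: fa.
Qed.

Lemma rep_max Q f :
  rep Q f -> f = 0 \/ exists2 u, Q u & rep (fun v => le v u /\ Q v) f.
Proof.
have [[le_refl _ le_trans le_total] _ _] := tole.
elim=> [|c p f' [m [a [fa Qa ->]]] _ IH]; [by left | right].
case: IH => [->|[u Qu ru]].
  exists (m + mon a)%MM => //; apply: lspanD (lspan0 _).
  by exists m, a; split.
have [au|ua] := orP (le_total (m + mon a)%MM u).
  by exists u => //; apply: lspanD ru; exists m, a; split.
exists (m + mon a)%MM => //; apply: lspanD; first by exists m, a; split.
by apply: rep_weaken ru => v [vu Qv]; split=> //; apply: le_trans ua.
Qed.

(** All summands with leading monomial [u] can be collected into a single one, since [sim] trades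
    one face for another modulo lower terms. *)
Lemma rep_lead D u f : (mdeg u <= D)%N -> rep (le_deg D u) f ->
  rep (lt_deg D u) f \/
  exists a, exists2 c : K, dface Gamma a /\ (mon a <= u)%MM &
    rep (lt_deg D u) (f - c *: ('X_[u - mon a] * det a)).
Proof.
move=> uD; elim=> [|c p f' [m [a [fa [leu lD] ->]]] _ IH].
  by left; apply: lspan0.
have [eq_u|neq_u] := eqVneq (m + mon a)%MM u; last first.
  have pu : rep (lt_deg D u) (c *: ('X_[m] * det a)).
    by apply/lspan_scale/rep_gen => //; split=> //; rewrite /strict leu.
  case: IH => [rf'|[b [c' fb rf']]]; first by left; apply: lspan_add.
  by right; exists b, c' => //; rewrite -addrA; apply: lspan_add.
have au : (mon a <= u)%MM by rewrite -eq_u lem_addl.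
have -> : m = (u - mon a)%MM by rewrite -eq_u addmK.
right; case: IH => [rf'|[b [c' [fb bu] rf']]].
  by exists a, c => //; rewrite addrC addKr.
exists b, (c + c') => //; rewrite (_ : _ - _ =
  c *: ('X_[u - mon a] * det a - 'X_[u - mon b] * det b) +
  (f' - c' *: ('X_[u - mon b] * det b))); last first.
  by rewrite scalerBr scalerDl opprD addrACA.
apply: lspan_add => //; apply: lspan_scale.
apply: rep_weaken (sim_dface K tole mon_lt_diag ui fa fb au bu) => v [vu eqd].
by split; rewrite ?eqd.
Qed.

(** Induction on the number of monomials of degree at most [D] below the bound [u] of the
    representation. If the summands at [u] collect to zero, the bound drops; otherwise nothing
    cancels [u], which is then the initial monomial of [f]. *)
Lemma rep_initial D f : f != 0 -> rep (fun v => mdeg v <= D)%N f ->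
  exists2 a, dface Gamma a & (mon a <= initial_monomial le f)%MM.
Proof.
move=> f0 /rep_max[/eqP|[u]]; first by rewrite (negPf f0).
have [N] := ubnP #|[pred x : 'X_{1..(d.+1 * n)%N < D.+1} | strict le x u]|.
elim: N => // N IH in u * => ltN uD /(rep_lead uD) lead.
have smaller : rep (lt_deg D u) f ->
    exists2 a, dface Gamma a & (mon a <= initial_monomial le f)%MM.
  case/rep_max=> [/eqP|[u' [ltu u'D]]]; first by rewrite (negPf f0).
  move=> rf; apply: (IH u') => //; last first.
    by apply: rep_weaken rf => v [? []].
  apply: leq_trans (ltN : _ <= N)%N; apply: proper_card; apply/properP; split.
    by apply/subsetP => v; rewrite !inE => /(strict_le_trans tole); apply; case/andP: ltu.
  by exists (BMultinom (u'D : mdeg u' < D.+1)%N); rewrite !inE //= /strict eqxx andbF.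
case: lead => // -[a [c [fa au]]]; have [->|c0] := eqVneq c 0.
  by rewrite scale0r subr0.
move=> rg; exists a => //; have inca : increasing a by case: fa.
set g := _ - _ in rg; have fE : f = c *: ('X_[u - mon a] * det a) + g.
  by rewrite /g addrC subrK.
have g_lt v : v \in msupp g -> strict le v u.
  by case/(rep_msupp rg) => w [wu _] vw; apply: (le_strict_trans tole) wu.
have -> // : initial_monomial le f = u.
apply: initial_unique => //.
  have lead1 : ('X_[u - mon a] * det a)@_u = 1.
    by rewrite mulrC -[X in _@_X](submK au) mcoeffMX det_coeff.
  rewrite mcoeff_msupp fE mcoeffD mcoeffZ lead1 mulr1.
  rewrite memN_msupp_eq0 ?addr0 //; apply/negP => /g_lt.
  by rewrite /strict eqxx andbF.
move=> v; rewrite fE => /msuppD_le; rewrite mem_cat => /orP[|/g_lt/andP[]//].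
move/msuppZ_le; rewrite mulrC (perm_mem (msuppMX _ _)) => /mapP[w wa ->].
rewrite -{2}(submK au) ![(u - mon a + _)%MM]addmC.
by case: tole => _ _; apply; apply: det_le.
Qed.

Lemma det_facet_ideal_rep f : det_facet_ideal Gamma f -> rep xpredT f.
Proof.
case=> s sG ->; rewrite big_seq; apply: lspan_sum => p /sG[a fa ->].
rewrite [p.1]mpolyE mulr_suml; apply: lspan_sum => m _.
by rewrite -scalerAl; apply/lspan_scale/rep_gen.
Qed.

Lemma rep_bounded Q f : rep Q f -> exists D, rep (fun v => mdeg v <= D)%N f.
Proof.
elim=> [|c p f' [m [a [fa _ ->]]] _ [D rD]]; first by exists 0%N; apply: lspan0.
exists (maxn D (mdeg (m + mon a))); apply: lspanD.
  by exists m, a; split=> //; apply: leq_maxr.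
by apply: rep_weaken rD => v vD; apply: leq_trans vD (leq_maxl _ _).
Qed.

Lemma unit_interval_groebner :
  groebner_basis le (@facet_minors K d n Gamma) (@det_facet_ideal K d n Gamma).
Proof.
split=> [g|f]; first exact: ideal_gen_gen.
split; apply: ideal_gen_bind => t [g Jg ->]; last first.
  by apply: ideal_gen_gen; exists g => //; apply: ideal_gen_gen.
have [->|g0] := eqVneq g 0.
  by rewrite /initial_term mcoeff0 scale0r; apply: ideal_gen0.
have [D rg] := rep_bounded (det_facet_ideal_rep Jg).
have [a fa] := rep_initial g0 rg.
rewrite [initial_term le g]/initial_term; set u := initial_monomial le g => au.
rewrite -[u in 'X_[u]](submK au) mpolyXD scalerAl.
apply/ideal_gen_mul/ideal_gen_gen; exists (det a); first by exists a.
by rewrite initial_term_det //; case: fa.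
Qed.

End Groebner.

(** * Traceability of unit-interval complexes *)

Section Consecutive.
Variables (d n : nat).

(** [x0] is only the default of [insubd], never returned when i + d < n. *)
Definition consecutive (x0 : 'I_n) (i : nat) (j : 'I_d.+1) : 'I_n :=
  insubd x0 (i + j).

Lemma consecutiveE x0 i j : i + d < n -> consecutive x0 i j = i + j :> nat.
Proof.
by move=> id_n; rewrite /consecutive val_insubd; have := leq_ord j; case: ltnP => //; lia.
Qed.

Lemma consecutive_increasing x0 i : i + d < n -> increasing (consecutive x0 i).
Proof. by move=> id_n j k jk; rewrite !consecutiveE ?ltn_add2l. Qed.

Lemma consecutive_image x0 i : i + d < n ->
  [set consecutive x0 i j | j : 'I_d.+1] = [set k : 'I_n | i <= k <= i + d].
Proof.
move=> id_n; apply/setP => k; rewrite inE; apply/imsetP/andP => [[j _ ->]|[ik kid]].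
  by rewrite consecutiveE // leq_addr leq_add2l leq_ord.
have kid' : k - i < d.+1 by lia.
exists (Ordinal kid') => //; apply: ord_inj.
by rewrite consecutiveE //= subnKC.
Qed.

Lemma increasing_of_set (G : {set 'I_n}) : #|G| = d.+1 ->
  exists2 a : 'I_d.+1 -> 'I_n, increasing a & [set a i | i : 'I_d.+1] = G.
Proof.
move=> cardG; have lt_card (i : 'I_d.+1) : i < #|G| by rewrite cardG.
exists (fun i => Order.enum_val (Ordinal (lt_card i))).
  move=> i j ij; have := Order.le_enum_val (@Order.TotalTheory.le_total _ _)
    (Ordinal (lt_card j)) (Ordinal (lt_card i)).
  by rewrite !leEord /= => le_ji; rewrite ltnNge le_ji -ltnNge.
apply/setP => x; apply/imsetP/idP => [[i _ ->]|xG]; first exact: Order.enum_valP.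
have ltr : Order.enum_rank_in xG x < d.+1 by rewrite -cardG.
exists (Ordinal ltr) => //; rewrite -[LHS](Order.enum_rankK_in xG xG).
by congr Order.enum_val; apply: val_inj.
Qed.

End Consecutive.

Section Traceable.
Variables (V : finType) (n d : nat) (Delta : {set {set V}}) (lab : V -> 'I_n).
Hypothesis d_gt0 : 0 < d.
Hypothesis sc : simplicial_complex Delta.
Hypothesis conn : strongly_connected Delta d.
Hypothesis lab_bij : bijective lab.
Hypothesis ui : unit_interval_labeled d (relabel lab Delta).

Lemma unit_interval_traceable : traceable_labeled d (relabel lab Delta).
Proof.
move=> i id_n; have [pureD connD] := conn; have [_ vertexD _] := sc.
have lab_inj := bij_inj lab_bij; have [bal balK labK] := lab_bij.
have facet_of x : exists2 F, F \in facets Delta & bal x \in F.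
  have [F maxF vF] := @maxset_exists _ (fun G => G \in Delta) _ (vertexD (bal x)).
  by exists F; rewrite ?inE // -sub1set.
have lt_in : i < n by apply: leq_ltn_trans id_n; apply: leq_addr.
have [F0 F0D iF0] := facet_of (Ordinal lt_in).
have [F1 F1D iF1] := facet_of (Ordinal id_n).
(* A facet that is both [low] and [high] has the block i, ..., i + d inside its interval. [F0] is
   low and [F1] is high, so otherwise a path from [F0] to [F1] must leave the low facets. *)
pose low (F : {set V}) := [exists v in F, lab v <= i].
pose high (F : {set V}) := [exists v in F, i + d <= lab v].
have [/exists_inP[F FD /andP[lowF highF]]|] :=
    boolP [exists F in facets Delta, low F && high F].
  have FDel : F \in Delta by move: FD; rewrite inE => /maxsetp.
  have cardF : #|lab @: F| = d.+1 by rewrite card_imset // pureD.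
  have [a inca aF] := increasing_of_set cardF.
  have fa : dface (relabel lab Delta) a by split=> //; rewrite aF imset_f.
  have lab_a v : v \in F -> exists j, lab v = a j.
    by move=> /(imset_f lab); rewrite -aF => /imsetP[j _ ->]; exists j.
  case/exists_inP: lowF => v /lab_a[j ->] ai.
  case/exists_inP: highF => w /lab_a[k ->] ia.
  rewrite -(consecutive_image (Ordinal id_n)) //.
  have inc := consecutive_increasing (Ordinal id_n) id_n.
  have [] // := unit_interval_dface ui fa inc; rewrite consecutiveE //.
    by rewrite addn0; apply: leq_trans ai; apply: increasing_min.
  by apply: leq_trans ia _; apply: increasing_max.
rewrite negb_exists_in => /forall_inP noF.
have step F G : dual_graph Delta d F G -> low F -> low G.
  case/and3P=> FD GD /eqP cardFG lowF; apply: contraT => lowG.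
  have highF : ~~ high F by have := noF F FD; rewrite lowF.
  (* The d common labels lie strictly between i and i + d. Together with these endpoints, distinct
     as d > 0, they would be d + 2 labels in a block of d + 1. *)
  pose S := lab @: (F :&: G).
  have inS k : k \in S -> i < k < i + d.
    case/imsetP=> v; rewrite inE => /andP[vF vG] ->; apply/andP; split.
      by move: lowG; rewrite negb_exists_in => /forall_inP hv; rewrite ltnNge; apply: hv.
    by move: highF; rewrite negb_exists_in => /forall_inP hv; rewrite ltnNge; apply: hv.
  have : Ordinal lt_in |: (Ordinal id_n |: S) \subset [set k : 'I_n | i <= k <= i + d].
    apply/subsetP => k; rewrite !inE => /or3P[/eqP ->|/eqP ->|/inS] /=; lia.
  move/subset_leq_card; rewrite -(consecutive_image (Ordinal id_n)) //.
  rewrite (card_increasing (consecutive_increasing _ id_n)) !cardsU1.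
  rewrite card_imset // cardFG !inE -val_eqE /= negb_or.
  have -> : Ordinal lt_in \notin S by apply/negP => /inS /=; lia.
  have -> : Ordinal id_n \notin S by apply/negP => /inS /=; lia.
  lia.
have low1 : low F1.
  have /connectP[p] := connD _ _ F0D F1D.
  have: low F0 by apply/exists_inP; exists (bal (Ordinal lt_in)); rewrite ?labK /=.
  elim: p F0 {F0D iF0} => [|G p IH] F /= lowF; first by move=> _ ->.
  by case/andP=> FG; apply: IH; apply: step FG lowF.
have := noF _ F1D; rewrite low1 => /negP[].
by apply/exists_inP; exists (bal (Ordinal id_n)); rewrite ?labK /=.
Qed.

End Traceable.

(** * Diagonal weight orders and exchange of vertices *)

Section WeightOrder.
Variables (m : nat) (w : 'I_m -> nat).
Implicit Types u v : 'X_{1..m}.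

Definition weight u := \sum_(k < m) u k * w k.

Lemma weight0 : weight 0%MM = 0.
Proof. by rewrite /weight big1 // => k _; rewrite mnm0E. Qed.

Lemma weightD u v : weight (u + v)%MM = weight u + weight v.
Proof. by rewrite -big_split; apply: eq_bigr => k _; rewrite mnmDE mulnDl. Qed.

Lemma weight_mnm1 k : weight U_(k)%MM = w k.
Proof.
rewrite /weight (bigD1 k) //= mnm1E eqxx mul1n big1 ?addn0 // => i ik.
by rewrite mnm1E eq_sym (negPf ik).
Qed.

Lemma weight_sum (I : Type) (r : seq I) (P : pred I) (F : I -> 'X_{1..m}) :
  weight (\sum_(i <- r | P i) F i)%MM = \sum_(i <- r | P i) weight (F i).
Proof. exact: (big_morph _ weightD weight0). Qed.

(** Ties are broken by the monomial order [<=%O], so that every weight yields a term order. *)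
Definition weight_le : rel 'X_{1..m} :=
  fun u v => (weight u < weight v) || (weight u == weight v) && (u <= v)%O.

Lemma weight_lt_le u v : weight u < weight v -> weight_le u v.
Proof. by rewrite /weight_le => ->. Qed.

Lemma weight_term_order : term_order weight_le.
Proof.
split; last 1 first.
- move=> u v t; rewrite /weight_le !weightD ltn_add2r eqn_add2r.
  by rewrite lemc_add2l.
- split=> [u|u v|v u t|u v]; rewrite /weight_le.
  + by rewrite eqxx Order.POrderTheory.lexx orbT.
  + case: ltngtP => //= _; exact: Order.POrderTheory.le_anti.
  + case/orP=> [uv|/andP[/eqP-> uv]] /orP[vt|/andP[/eqP<- vt]].
    * by rewrite (ltn_trans uv vt).
    * by rewrite uv.
    * by rewrite vt.
    * by rewrite eqxx (Order.POrderTheory.le_trans uv vt) orbT.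
  + by case: ltngtP => //= _; exact: Order.TotalTheory.le_total.
- move=> u; rewrite /weight_le weight0 le0m andbT; lia.
Qed.

End WeightOrder.

(** * Rearrangement inequalities on final segments of indices *)

Section Rearrangement.
Variables (r n : nat) (c : 'I_r -> 'I_n) (s : 'S_r).
Hypothesis inc : increasing c.

(** The sums of [i] and of [s i] agree, so [i <= s i] everywhere forces equality everywhere. *)
Lemma perm_lt : s != 1%g -> exists i, s i < i.
Proof.
move=> s1; apply/existsP; apply: contraT; rewrite negb_exists => /forallP le_s.
have le_i (i : 'I_r) : i <= s i ?= iff (i == s i :> nat).
  by split=> //; rewrite leqNgt.
have [_] := leqif_sum (fun i (_ : xpredT i) => le_i i).
rewrite [X in _ == X](_ : _ = \sum_(i < r) i); last by rewrite [RHS](reindex_perm s).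
rewrite eqxx => /esym/forallP eqs.
case/eqP: s1; apply/permP => i; rewrite perm1; apply: val_inj.
by have /= /eqP := eqs i.
Qed.

Variable U : pred 'I_r.
Hypothesis upU : forall i j : 'I_r, U i -> i <= j -> U j.

(** If [s] mapped the finite set [U] into itself it would permute it, and nothing outside could
    enter. *)
Lemma perm_upset_out i : U (s i) -> ~~ U i -> exists2 j, U j & ~~ U (s j).
Proof.
move=> Usi nUi; have [/exists_inP //|] := boolP [exists j in U, ~~ U (s j)].
rewrite negb_exists_in => /forall_inP inU.
have sub : s @: [set j | U j] \subset [set j | U j].
  apply/subsetP => _ /imsetP[j Uj ->]; rewrite inE in Uj; rewrite inE.
  by rewrite -[U _]negbK inU.
have eqU : s @: [set j | U j] = [set j | U j].
  by apply/eqP; rewrite eqEcard sub (card_imset _ (@perm_inj _ s)) leqnn.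
have : s i \in s @: [set j | U j] by rewrite eqU inE.
by rewrite (mem_imset _ _ (@perm_inj _ s)) inE (negPf nUi).
Qed.

(** Threshold just above the values of [c] outside [U], so that [U] is cut out by [t <= c i]. *)
Let t := \max_(i | ~~ U i) (c i).+1.

Let UE i : U i = (t <= c i).
Proof.
apply/idP/idP => [Ui|]; last first.
  apply: contraLR => nUi; rewrite -ltnNge.
  exact: (@leq_bigmax_cond _ (fun i => ~~ U i) (fun i => (c i).+1) i nUi).
apply/bigmax_leqP => j; apply: contraR; rewrite -ltnNge => ij.
apply: (upU Ui); apply: contraLR ij; rewrite -!ltnNge ltnS => ji.
exact: inc ji.
Qed.

(** The truncated difference [c i - t] vanishes outside [U], so its sum over [U] is the full sum,
    which [s] preserves. Adding [t] back turns [c (s i)] into its maximum with [t], whence the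
    strict version below. *)
Let shifted_le : \sum_(i | U i) (c (s i) - t + t) <= \sum_(i | U i) c i.
Proof.
rewrite [leqRHS](eq_bigr (fun i => c i - t + t)); last first.
  by move=> i; rewrite UE => /subnK.
rewrite !big_split leq_add2r.
have -> : \sum_(i | U i) (c i - t) = \sum_i (c i - t).
  rewrite [RHS](bigID U) /= [X in _ + X]big1 ?addn0 // => i.
  by rewrite UE -ltnNge => /ltnW; rewrite -subn_eq0 => /eqP.
rewrite [leqRHS](reindex_perm s) [leqRHS](bigID U) /=.
exact: leq_addr.
Qed.

Lemma sum_upset_le : \sum_(i | U i) c (s i) <= \sum_(i | U i) c i.
Proof. by apply: leq_trans shifted_le; apply: leq_sum => i _; lia. Qed.

Lemma sum_upset_lt i : U i -> ~~ U (s i) ->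
  \sum_(j | U j) c (s j) < \sum_(j | U j) c j.
Proof.
move=> Ui; rewrite UE => nUsi; apply: leq_trans shifted_le.
rewrite (bigD1 i) // [ltnRHS](bigD1 i) //=.
rewrite -addSn; apply: leq_add; last by apply: leq_sum => j _; lia.
by rewrite -ltnNge in nUsi; apply: leq_trans nUsi (leq_addl _ _).
Qed.

End Rearrangement.

Section RowWeights.
Local Open Scope ring_scope.
Variables (K : fieldType) (d n : nat) (gap : 'I_d.+1 -> nat).

Definition row_weight (i : 'I_d.+1) : nat := \sum_(p < d.+1 | (p <= i)%N) gap p.

Definition cell_weight : 'I_(d.+1 * n) -> nat :=
  mxvec (\matrix_(i < d.+1, j < n) (row_weight i * j)%N) 0.

Local Notation W := (weight cell_weight).

Lemma weight_place_mon r (al : 'I_r -> 'I_d.+1) (c : 'I_r -> 'I_n) :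
  W (place_mon al c) = (\sum_(i < r) row_weight (al i) * c i)%N.
Proof.
rewrite weight_sum; apply: eq_bigr => i _.
by rewrite weight_mnm1 /cell_weight mxvecE mxE.
Qed.

(** Abel summation: each threshold row [p] contributes a sum over a final segment, to which the
    rearrangement inequalities apply. *)
Lemma weight_place_mon_gap r (al : 'I_r -> 'I_d.+1) (c : 'I_r -> 'I_n) :
  W (place_mon al c) =
  (\sum_(p < d.+1) gap p * \sum_(i < r | p <= al i) c i)%N.
Proof.
rewrite weight_place_mon (eq_bigr (fun i =>
  (\sum_(p < d.+1 | p <= al i) gap p * c i)%N)); last first.
  by move=> i _; rewrite /row_weight big_distrl.
rewrite (exchange_big_dep xpredT) //=.
by apply: eq_bigr => p _; rewrite big_distrr.
Qed.

Section Cost.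
Variables (r : nat) (al : 'I_r -> 'I_d.+1) (c : 'I_r -> 'I_n) (s : 'S_r).
Hypotheses (inca : increasing al) (incc : increasing c).

Let up (p : 'I_d.+1) (i j : 'I_r) : (p <= al i -> i <= j -> p <= al j)%N.
Proof. by move=> pi ij; apply: leq_trans pi (increasing_le inca ij). Qed.

(** Position [i] of the segment of [p] takes its column from outside, so that partial sum drops by
    at least 1, which is worth [gap p]; no other partial sum grows. *)
Lemma weight_perm_gap (p : 'I_d.+1) i : (p <= al i)%N -> (al (s i) < p)%N ->
  (W (place_mon al (c \o s)) + gap p <= W (place_mon al c))%N.
Proof.
move=> pi sip; rewrite !weight_place_mon_gap.
rewrite (bigD1 p) // [leqRHS](bigD1 p) //=.
have lt_p : (\sum_(j < r | p <= al j) c (s j) < \sum_(j < r | p <= al j) c j)%N.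
  apply: (@sum_upset_lt r n c s incc (fun j => p <= al j)%N (@up p) i pi).
  by rewrite -ltnNge.
have le_rest : (\sum_(q < d.+1 | q != p) gap q * \sum_(j < r | q <= al j) c (s j)
    <= \sum_(q < d.+1 | q != p) gap q * \sum_(j < r | q <= al j) c j)%N.
  apply: leq_sum => q _; rewrite leq_mul2l; apply/orP; right.
  exact: (@sum_upset_le r n c s incc (fun j => q <= al j)%N (@up q)).
rewrite addnAC; apply: leq_add; last exact: le_rest.
by rewrite addnC -mulnS leq_mul2l lt_p orbT.
Qed.

End Cost.

Lemma weight_diagonal : (forall p, 0 < gap p)%N ->
  diagonal K (weight_le cell_weight).
Proof.
move=> gap_gt0 r al c inca incc; have tole := weight_term_order cell_weight.
have [[le_refl _ _ _] _ _] := tole.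
have coeff1 : (minor K al c)@_(place_mon al c) = 1.
  rewrite -[RHS](expr0 (-1)) -[0%N]/(false : nat) -(odd_perm1 'I_r.+1).
  rewrite -(minor_coeff K 1%g (increasing_inj inca) (increasing_inj incc)).
  by congr _@_(_); apply: eq_bigr => i _ /=; rewrite perm1.
have init : initial_monomial (weight_le cell_weight) (minor K al c) = place_mon al c.
  apply: initial_unique => //; first by rewrite mcoeff_msupp coeff1 oner_neq0.
  move=> v /minor_msupp[s ->]; have [->|/perm_lt[i si]] := eqVneq s 1%g.
    rewrite (_ : place_mon _ _ = place_mon al c) //.
    by apply: eq_bigr => i _ /=; rewrite perm1.
  apply: weight_lt_le.
  have := weight_perm_gap inca incc (leqnn (al i)) (inca _ _ si).
  by have := gap_gt0 (al i); lia.
by rewrite /initial_term init coeff1 scale1r mprodXE.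
Qed.

End RowWeights.

(** * Faces forced by S-polynomials *)

Section Exchange.
Local Open Scope ring_scope.
Variables (K : fieldType) (d n : nat) (Gamma : {set {set 'I_n}}).
Hypothesis groebner : forall le : rel 'X_{1..d.+1 * n},
  term_order le -> diagonal K le ->
  groebner_basis le (@facet_minors K d n Gamma) (@det_facet_ideal K d n Gamma).

Implicit Types (a b c : 'I_d.+1 -> 'I_n).
Local Notation det a := (minor K id a).

Section Adjacent.
Variables k k1 : 'I_d.+1.
Hypothesis k1E : k1 = k.+1 :> nat.

(* The weight of x_ij is (the sum of the gaps up to row i) * j, so exchanging
   rows k and k1 costs c k1 - c k < n, less than crossing any other gap. *)
Definition adjacent_gap (p : 'I_d.+1) : nat := if p == k1 then 1%N else n.

Local Notation W := (weight (@cell_weight d n adjacent_gap)).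
Local Notation tau := (tperm k k1).

Let kk1 : k != k1. Proof. by rewrite -val_eqE /= k1E; lia. Qed.

(** A permutation other than 1 and [tau] moves some index outside [k] and [k1], hence crosses a
    threshold of gap [n]. *)
Lemma weight_perm_nonadjacent c (s : 'S_d.+1) :
  increasing c -> s != 1%g -> s != tau -> (W (mon (c \o s)) + n <= W (mon c))%N.
Proof.
move=> incc s1 st.
have [i [ik ik1 sii]] : exists i, [/\ i != k, i != k1 & s i != i].
  have [/existsP[i /and3P[]]|] :=
      boolP [exists i, [&& i != k, i != k1 & s i != i]]; first by exists i.
  rewrite negb_exists => /forallP fixs.
  have fix_s i : i != k -> i != k1 -> s i = i.
    by move=> ik ik1; have := fixs i; rewrite ik ik1 /= negbK => /eqP.
  have s_k : s k = k \/ s k = k1.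
    have [|sk] := eqVneq (s k) k; [by left|].
    have [|sk1] := eqVneq (s k) k1; first by right.
    by have /perm_inj := fix_s _ sk sk1 => /eqP; rewrite (negPf sk).
  have s_k1 : s k1 = k \/ s k1 = k1.
    have [|sk] := eqVneq (s k1) k; [by left|].
    have [|sk1] := eqVneq (s k1) k1; first by right.
    by have /perm_inj := fix_s _ sk sk1 => /eqP; rewrite (negPf sk1).
  have skk1 : s k != s k1 by rewrite (inj_eq perm_inj).
  case: s_k => sk.
    case/eqP: s1; apply/permP => i; rewrite perm1.
    have [->//|ik] := eqVneq i k; have [->|ik1] := eqVneq i k1; last exact: fix_s.
    by case: s_k1 => // sk1; rewrite sk sk1 eqxx in skk1.
  case/eqP: st; apply/permP => i.
  case: tpermP => [->//|->|/eqP ik /eqP ik1]; last exact: fix_s.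
  by case: s_k1 => // sk1; rewrite sk sk1 eqxx in skk1.
have gapE (p : 'I_d.+1) : p != k1 -> adjacent_gap p = n.
  by rewrite /adjacent_gap => /negPf ->.
have inc_id : increasing (id : 'I_d.+1 -> 'I_d.+1) by [].
have [si|si|/val_inj /eqP] := ltngtP (s i) i; last by rewrite (negPf sii).
  by have := weight_perm_gap adjacent_gap inc_id incc (leqnn i) si; rewrite gapE.
have lti : (i.+1 < d.+1)%N by apply: leq_ltn_trans si (ltn_ord _).
(* Since [s] moves [i] up across threshold i + 1, some [j] crosses it downwards; this threshold is
   not [k1] because [i != k]. *)
pose p := Ordinal lti; have pk1 : p != k1 by rewrite -val_eqE /= k1E eqSS.
have [j pj sj] := @perm_upset_out _ s (fun j => p <= j)%N i si (negbT (ltnn i)).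
rewrite -ltnNge in sj.
by have := weight_perm_gap adjacent_gap inc_id incc pj sj; rewrite gapE.
Qed.

Lemma weight_tperm c : (W (mon (c \o tau)) + c k1 = W (mon c) + c k)%N.
Proof.
have wk1 : row_weight adjacent_gap k1 = (row_weight adjacent_gap k).+1.
  rewrite /row_weight (bigD1 k1) //= /adjacent_gap eqxx add1n; congr _.+1.
  by apply: eq_bigl => p; rewrite k1E -val_eqE /= k1E; lia.
rewrite !weight_place_mon (bigD1 k) // [in RHS](bigD1 k) //=.
rewrite (bigD1 k1) 1?eq_sym // [in RHS](bigD1 k1) 1?eq_sym //= tpermL tpermR wk1.
rewrite (eq_bigr (fun i => row_weight adjacent_gap i * c i)%N); first by lia.
by move=> i /andP[ik ik1]; rewrite tpermD // eq_sym.
Qed.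

Lemma weight_perm_adjacent c (s : 'S_d.+1) : increasing c -> s != 1%g ->
  (W (mon (c \o s)) + c k1 <= W (mon c) + c k)%N.
Proof.
move=> incc s1; have [->|st] := eqVneq s tau; first exact: eq_leq (weight_tperm c).
by have := weight_perm_nonadjacent incc s1 st; have := ltn_ord (c k1); lia.
Qed.

Lemma lspan_msupp (Q : 'X_{1..d.+1 * n} -> Prop) (f : {mpoly K[d.+1 * n]}) v :
  lspan (fun p => exists2 u, Q u & p = 'X_[u]) f -> v \in msupp f -> Q v.
Proof.
elim=> [|c p f' [u Qu ->] _ IH]; first by rewrite msupp0.
move/msuppD_le; rewrite mem_cat => /orP[/msuppZ_le|/IH //].
by rewrite msuppX inE => /eqP ->.
Qed.

(** The cost condition makes [w], coming from the [tau] term of [b], the initial monomial of the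
    S-polynomial. Some diagonal monomial of a face [c] divides it, and each row then leaves the
    stated choices for [c i]. *)
Lemma exchange a b : dface Gamma a -> dface Gamma b ->
  (b k1 + a k < a k1 + b k)%N ->
  exists2 c, dface Gamma c & forall i,
    (a i == c i) && (b i != c i) || (b (tau i) == c i).
Proof.
move=> fa fb cost; have [[inca _] [incb _]] := (fa, fb).
set u := mlcm (mon a) (mon b).
have au : (mon a <= u)%MM := lem_mlcml _ _.
have bu : (mon b <= u)%MM := lem_mlcmr _ _.
pose w := ((u - mon b) + mon (b \o tau))%MM.
pose le := weight_le (@cell_weight d n adjacent_gap).
have tole : term_order le := weight_term_order _.
have diag : diagonal K le.
  apply: weight_diagonal => p; rewrite /adjacent_gap; case: eqP => // _.
  exact: leq_ltn_trans (leq0n _) (ltn_ord (a k)).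
have tau1 : tau != 1%g.
  apply: contraNneq kk1 => t1; have := tpermL k k1.
  by rewrite t1 perm1 => {1}->.
have Wa := weightD (@cell_weight d n adjacent_gap) (u - mon a) (mon a).
have Wb := weightD (@cell_weight d n adjacent_gap) (u - mon b) (mon b).
rewrite submK // in Wa; rewrite submK // in Wb.
have Ww := weightD (@cell_weight d n adjacent_gap) (u - mon b) (mon (b \o tau)).
rewrite -/w in Ww; have Wtb := weight_tperm b; have Wta := weight_tperm a.
have ltbn := ltn_ord (b k1).
pose S := 'X_[u - mon a] * det a - 'X_[u - mon b] * det b.
pose R := S + (-1) ^+ tau *: 'X_[w].
(* The diagonal terms cancel and [R] omits the [tau] term of [b]. Other terms from [a] lose at least
   a_k1 - a_k and those from [b] at least n, both more than the loss b_k1 - b_k of [w]. *)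
have lower : lspan (fun p => exists2 v, (W v < W w)%N & p = 'X_[v]) R.
  rewrite /R /S !minor_tail !mulrDr -!mpolyXD !submK //.
  rewrite opprD addrACA subrr add0r [X in _ - 'X_[_] * X](bigD1 tau) //=.
  rewrite mulrDr -scalerAr -mpolyXD -/w opprD addrA addrAC addrNK.
  rewrite !mulr_sumr; apply: lspan_add; last apply: lspan_opp.
    apply: lspan_sum => s s1; rewrite -scalerAr -mpolyXD.
    apply/lspan_scale/lspan_gen; exists (u - mon a + mon (a \o s))%MM => //.
    by rewrite weightD; have := weight_perm_adjacent inca s1; lia.
  apply: lspan_sum => s /andP[s1 st]; rewrite -scalerAr -mpolyXD.
  apply/lspan_scale/lspan_gen; exists (u - mon b + mon (b \o s))%MM => //.
  rewrite weightD; set Ws := weight _ (mon (b \o s)).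
  have : (Ws + n <= W (mon b))%N := weight_perm_nonadjacent incb s1 st.
  lia.
have Sw : S@_w != 0.
  have -> : S = R - (-1) ^+ tau *: 'X_[w] by rewrite /R addrK.
  rewrite mcoeffB mcoeffZ mcoeffX eqxx mulr1.
  rewrite memN_msupp_eq0 ?sub0r ?oppr_eq0 ?signr_eq0 //.
  by apply/negP => /(lspan_msupp lower); rewrite ltnn.
have initS : initial_monomial le S = w.
  apply: initial_unique; rewrite ?mcoeff_msupp // => v.
  have -> : S = R - (-1) ^+ tau *: 'X_[w] by rewrite /R addrK.
  move/msuppB_le; rewrite mem_cat => /orP[/(lspan_msupp lower)|/msuppZ_le].
    exact: weight_lt_le.
  rewrite msuppX inE => /eqP ->.
  by case: tole => [[refl _ _ _] _ _]; apply: refl.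
have SJ : det_facet_ideal Gamma S.
  apply: ideal_gen_add; last rewrite -mulNr; apply/ideal_gen_mul/ideal_gen_gen.
    by exists a.
  by exists b.
have [_ /(_ (initial_term le S))[inJG _]] := groebner tole diag.
have [|s sG eqs] := inJG; first by apply: ideal_gen_gen; exists S.
have : w \in msupp (initial_term le S).
  by rewrite /initial_term initS mcoeff_msupp mcoeffZ mcoeffX eqxx mulr1.
rewrite eqs => /msupp_sum_le /flatten_mapP[p]; rewrite mem_filter /= => ps.
have [_ [c fc ->] ->] := sG p ps; have [incc _] := fc.
rewrite (initial_term_det diag incc) (perm_mem (msuppMX _ _)) => /mapP[v _ wE].
(* A variable of [w] comes either from the lcm divided by the monomial of [b], hence from [a] where
   [b] differs, or from the permuted [b]. *)
exists c => // i; have : (0 < w (mxvec_index i (c i)))%N.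
  by rewrite wE mnmDE monE eqxx.
rewrite mnmDE mnmBE mnmE !monE /=.
by case: (a i == c i); case: (b i == c i); case: (b (tau i) == c i).
Qed.

End Adjacent.

(** Agreement at [k] leaves only [b k1] for [c k]; then [c k1 = b k] would contradict that [c]
    increases. *)
Lemma exchange_up (k k1 : 'I_d.+1) a b : k1 = k.+1 :> nat ->
  dface Gamma a -> dface Gamma b -> a k = b k -> (b k1 < a k1)%N ->
  exists2 c, dface Gamma c &
    [/\ c k = b k1, c k1 = a k1 &
        forall i, i != k -> i != k1 -> c i = a i \/ c i = b i].
Proof.
move=> k1E fa fb abk ltb.
have [|c fc cE] := @exchange k k1 k1E a b fa fb; first by rewrite abk; lia.
exists c => //; have ck : c k = b k1.
  by have := cE k; rewrite abk tpermL andbN => /eqP.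
split=> // [|i ik ik1].
  have := cE k1; rewrite tpermR => /orP[/andP[/eqP //]|/eqP ckb].
  have : (c k < c k1)%N by case: fc => inc _; apply: inc; rewrite k1E.
  have : (b k < b k1)%N by case: fb => inc _; apply: inc; rewrite k1E.
  by rewrite ck -ckb; lia.
have := cE i; rewrite tpermD 1?eq_sym // => /orP[/andP[/eqP ->]|/eqP ->]; auto.
Qed.

(** Mirror image: [c k1 = b k] is forced, and [c k = b k1] would contradict that [c] increases. *)
Lemma exchange_down (k k1 : 'I_d.+1) a b : k1 = k.+1 :> nat ->
  dface Gamma a -> dface Gamma b -> a k1 = b k1 -> (a k < b k)%N ->
  exists2 c, dface Gamma c &
    [/\ c k = a k, c k1 = b k &
        forall i, i != k -> i != k1 -> c i = a i \/ c i = b i].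
Proof.
move=> k1E fa fb abk ltb.
have [|c fc cE] := @exchange k k1 k1E a b fa fb; first by rewrite abk; lia.
exists c => //; have ck1 : c k1 = b k.
  by have := cE k1; rewrite abk tpermR andbN => /eqP.
split=> // [|i ik ik1].
  have := cE k; rewrite tpermL => /orP[/andP[/eqP //]|/eqP ckb].
  have : (c k < c k1)%N by case: fc => inc _; apply: inc; rewrite k1E.
  have : (b k < b k1)%N by case: fb => inc _; apply: inc; rewrite k1E.
  by rewrite ck1 -ckb; lia.
have := cE i; rewrite tpermD 1?eq_sym // => /orP[/andP[/eqP ->]|/eqP ->]; auto.
Qed.

End Exchange.

(** * Filling intervals by exchanges *)

Section InsertValues.
Variables (d n : nat) (k : 'I_d.+1) (p : 'I_n) (a : 'I_d.+1 -> 'I_n).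

Lemma insert_low (s : 'I_d.+2) (i : 'I_d.+1) :
  s = i :> nat -> i <= k -> insert k p a s = a i.
Proof.
move=> si ik; rewrite -(insert_lift k p a i); congr insert.
by apply: val_inj; rewrite /= /bump; lia.
Qed.

Lemma insert_mid (s : 'I_d.+2) : s = k.+1 :> nat -> insert k p a s = p.
Proof.
move=> sk; rewrite -[RHS](insert_lift0 k p a); congr insert.
by apply: val_inj; rewrite /= /bump; lia.
Qed.

Lemma insert_high (s : 'I_d.+2) (i : 'I_d.+1) :
  s = i.+1 :> nat -> k < i -> insert k p a s = a i.
Proof.
move=> si ik; rewrite -(insert_lift k p a i); congr insert.
by apply: val_inj; rewrite /= /bump; lia.
Qed.

End InsertValues.

(** [m] bounds the search: [d.+1] inspects every position, [d] ignores the last one. *)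
Lemma first_gap d n (a : 'I_d.+1 -> 'I_n) m : increasing a ->
  (forall i : 'I_d.+1, i < m -> a i = a ord0 + i :> nat) \/
  exists k k1 : 'I_d.+1, [/\ k1 = k.+1 :> nat, k1 < m,
    forall i : 'I_d.+1, i <= k -> a i = a ord0 + i :> nat & a ord0 + k1 < a k1].
Proof.
move=> inca; pose bad (i : 'I_d.+1) := (i < m) && (a i != a ord0 + i :> nat).
have [i0 bad0|good] := pickP bad; last first.
  by left=> i im; have := good i; rewrite /bad im /= => /negbFE/eqP.
right; have [i /andP[im ai] mini] := @arg_minnP _ i0 bad val bad0.
have good (j : 'I_d.+1) : j < i -> a j = a ord0 + j :> nat.
  move=> ji; apply/eqP; apply: contraT => aj.
  have := mini j; rewrite /bad aj (ltn_trans ji im) => /(_ isT) /=.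
  by rewrite leqNgt ji.
have lt_i : a ord0 + i < a i.
  by have := increasing_add inca (leq0n i : ord0 <= i); move: ai; rewrite subn0; lia.
have i_gt0 : 0 < i.
  by case: (posnP i) lt_i => // i0'; rewrite (_ : i = ord0) ?addn0 ?ltnn //; apply: val_inj.
have ltk : i.-1 < d.+1 by have := ltn_ord i; lia.
exists (Ordinal ltk), i; split=> //=; first by lia.
by move=> j ji; apply: good; lia.
Qed.

Section Converse.
Variables (K : fieldType) (d n : nat) (Gamma : {set {set 'I_n}}).
Hypothesis d_gt0 : 0 < d.
Hypothesis traceable : traceable_labeled d Gamma.
Hypothesis groebner : forall le : rel 'X_{1..d.+1 * n},
  term_order le -> diagonal K le ->
  groebner_basis le (@facet_minors K d n Gamma) (@det_facet_ideal K d n Gamma).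

Implicit Types (a b c : 'I_d.+1 -> 'I_n).
Local Notation dface := (dface Gamma).
Local Notation wide := (widen_ord (leqnSn d.+1)).

(** Two neighbouring deletions propagate both ways: deletions m and m + 1 give m + 2 by
    [exchange_down], and m + 1 and m + 2 give m by [exchange_up], each time at rows m and m + 1. *)
Lemma subfaces (e : 'I_d.+2 -> 'I_n) (k : 'I_d.+1) : increasing e ->
  dface (e \o lift (wide k)) -> dface (e \o lift (lift ord0 k)) ->
  forall s, dface (e \o lift s).
Proof.
move=> inc_e.
(* Natural indices make deletions plain arithmetic: [f m] is [e] without entry m. *)
pose E (i : nat) := e (inord i); pose f m (i : 'I_d.+1) := E (bump m i).
pose P m := dface (f m).
have fE (s : 'I_d.+2) : e \o lift s =1 f s.
  by move=> i; rewrite /f /E /= -[in LHS](inord_val (lift s i)).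
have ltE i j : i < j -> j < d.+2 -> E i < E j.
  by move=> ij jd; apply: inc_e; rewrite !inordK //; apply: ltn_trans jd.
move=> /(eq_dface (fE _)) Pk /(eq_dface (fE _)) Pk1 s.
suff: P s by apply: eq_dface => i; rewrite fE.
have up m : m.+2 <= d.+1 -> P m -> P m.+1 -> P m.+2.
  move=> md Pm Pm1; have ltm : m < d.+1 by lia.
  have ltm1 : m.+1 < d.+1 by lia.
  have [||c fc [cm cm1 co]] := @exchange_down K d n Gamma groebner
      (Ordinal ltm) (Ordinal ltm1) (f m.+1) (f m) erefl Pm1 Pm.
  - by rewrite /f /= /bump !leqnn leqnSn.
  - by rewrite /f /= /bump leqnn ltnn; apply: ltE; lia.
  apply: eq_dface fc => i.
  have [->|im] := eqVneq i (Ordinal ltm).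
    by rewrite cm /f /= /bump; congr E; lia.
  have [->|im1] := eqVneq i (Ordinal ltm1).
    by rewrite cm1 /f /= /bump; congr E; lia.
  rewrite -val_eqE /= in im; rewrite -val_eqE /= in im1.
  by case: (co i) => // ->; rewrite /f /bump; congr E; lia.
have down m : m.+2 <= d.+1 -> P m.+1 -> P m.+2 -> P m.
  move=> md Pm1 Pm2; have ltm : m < d.+1 by lia.
  have ltm1 : m.+1 < d.+1 by lia.
  have [||c fc [cm cm1 co]] := @exchange_up K d n Gamma groebner
      (Ordinal ltm) (Ordinal ltm1) (f m.+1) (f m.+2) erefl Pm1 Pm2.
  - by rewrite /f /= /bump; congr E; lia.
  - by rewrite /f /= /bump leqnn ltnn; apply: ltE; lia.
  apply: eq_dface fc => i.
  have [->|im] := eqVneq i (Ordinal ltm).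
    by rewrite cm /f /= /bump; congr E; lia.
  have [->|im1] := eqVneq i (Ordinal ltm1).
    by rewrite cm1 /f /= /bump; congr E; lia.
  rewrite -val_eqE /= in im; rewrite -val_eqE /= in im1.
  by case: (co i) => // ->; rewrite /f /bump; congr E; lia.
have up_all j : k + j <= d -> P (k + j) /\ P (k + j).+1.
  elim: j => [|j IH] kj; first by rewrite addn0.
  have [|Pj Pj1] := IH; first by lia.
  by rewrite addnS; split=> //; apply: up => //; lia.
have down_all j : j <= k -> P (k - j) /\ P (k - j).+1.
  elim: j => [|j IH] jk; first by rewrite subn0.
  have [|Pj Pj1] := IH; first by lia.
  have kj : (k - j.+1).+1 = k - j by lia.
  rewrite kj; split=> //; apply: down; rewrite ?kj //.
  by have := ltn_ord k; lia.
have ks := ltn_ord s; have [sk|ks'] := leqP s k.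
  by have [+ _] := down_all (k - s) (leq_subr _ _); rewrite subKn.
have [|_] := up_all (s - k.+1); first by lia.
by rewrite (_ : (k + _).+1 = s) //; lia.
Qed.

(** [p] is the first value missing from [a]. Exchanging [a] with the consecutive face starting at
    [a ord0] replaces [a k] by [p]; this and [a] are neighbouring deletions. *)
Lemma gap_subfaces a (k k1 : 'I_d.+1) (p : 'I_n) : dface a ->
  k1 = k.+1 :> nat -> (forall i : 'I_d.+1, i <= k -> a i = a ord0 + i :> nat) ->
  p = a ord0 + k1 :> nat -> p < a k1 ->
  increasing (insert k p a) /\ forall s, dface (insert k p a \o lift s).
Proof.
move=> fa k1E ak pE pk1; have [inca _] := fa.
have akE := ak k (leqnn k).
have inc_e : increasing (insert k p a).
  apply: insert_increasing => // [|i ki]; first by lia.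
  by apply: leq_trans pk1 _; apply: increasing_le => //; lia.
split=> //; apply: (subfaces (k := k)) => //; last first.
  by apply: eq_dface fa => i; rewrite /= insert_lift.
pose b := @consecutive d n p (a ord0).
have ad_n : a ord0 + d < n.
  have := increasing_add inca (leq0n (@ord_max d) : ord0 <= ord_max).
  by rewrite subn0 /= => /leq_ltn_trans; apply; apply: ltn_ord.
have bE i : b i = a ord0 + i :> nat by apply: consecutiveE.
have fb : dface b.
  split; first exact: consecutive_increasing.
  by rewrite consecutive_image //; apply: traceable.
have [||c fc [ck ck1 co]] := @exchange_up K d n Gamma groebner k k1 a b k1E fa fb.
- by apply: ord_inj; rewrite bE akE.
- by rewrite bE -pE.
have [incc _] := fc; apply: eq_dface fc => i; rewrite /= insert_wide.
have [->|ik] := eqVneq i k; first by apply: ord_inj; rewrite ck bE.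
have [->//|ik1] := eqVneq i k1.
have [ltik|] := ltnP i k.
  case: (co i ik ik1) => // ->; apply: ord_inj; rewrite bE (ak i) //; exact: ltnW.
move=> leki; have le_i : k1 <= i by move: ik ik1; rewrite -!val_eqE /=; lia.
(* Beyond [k1] the entry cannot come from the consecutive face: [c k1] is already past its
   consecutive value, and [c] increases. *)
case: (co i ik ik1) => // cb.
by have := increasing_add incc le_i; rewrite ck1 cb bE; lia.
Qed.

(* The vertex dropped is t_{d-1}, at position d of insert k p t. *)
Lemma gap_descent t (k k1 : 'I_d.+1) (p : 'I_n) :
  increasing t -> increasing (insert k p t) ->
  k1 = k.+1 :> nat -> k1 < d -> p < t k1 ->
  let t' := insert k p t \o lift (wide ord_max) in
  [/\ increasing t', t' ord0 = t ord0, t' ord_max = t ord_max &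
      \sum_i t' i < \sum_i t i].
Proof.
move=> inct ince k1E k1d pk1 t'; split.
- exact: increasing_lift.
- by rewrite /t' /=; apply: insert_low => //; rewrite /= /bump; lia.
- by rewrite /t' /=; apply: insert_high; rewrite /= /bump; lia.
have le_t i : t' i <= t i.
  rewrite -[t i](insert_lift k p t i); apply: increasing_le => //=.
  by rewrite /bump; lia.
rewrite (bigD1 k1) // [ltnRHS](bigD1 k1) //= -addSn; apply: leq_add.
  rewrite /t' /= insert_mid // /= /bump; lia.
by apply: leq_sum => i _; apply: le_t.
Qed.

(** Induction on the length of the interval, split by whether [c] misses the lower end, misses the
    upper end, or contains both. *)
Lemma interval_full a c : dface a -> increasing c ->
  a ord0 <= c ord0 -> c ord_max <= a ord_max -> dface c.
Proof.
have [N] := ubnP (a ord_max - a ord0); elim: N => // N IH in a c *.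
move=> ltN fa incc a0 am; have [inca _] := fa.
have incc_add (i : 'I_d.+1) := increasing_add incc (leq0n i : (ord0 : 'I_d.+1) <= i).
have incc_max (i : 'I_d.+1) := increasing_add incc (leq_ord i : i <= ord_max).
have [ag|[k [k1 [k1E _ ak ak1]]]] := first_gap d.+1 inca.
  apply: eq_dface fa => i; apply: ord_inj; rewrite (ag i) //.
  have := incc_add i; have := incc_max i; have := ag ord_max (ltnSn d).
  by have := ltn_ord i; rewrite /=; lia.
have ltdk : k < d by have := ltn_ord k1; lia.
have gap_d : a ord0 + d < a ord_max.
  have := increasing_add inca (leq_ord k1 : k1 <= ord_max).
  by have := ltn_ord k1; rewrite /=; lia.
have ltp : a ord0 + k1 < n by apply: ltn_trans ak1 (ltn_ord _).
pose p := Ordinal ltp.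
have [ince fe] := @gap_subfaces a k k1 p fa k1E ak erefl ak1.
(* Filling the first gap and dropping [a ord0] gives a face that spans exactly the interval
   shortened by one from below. *)
have upper b : increasing b -> a ord0 < b ord0 -> b ord_max <= a ord_max -> dface b.
  move=> incb ab0 bam.
  have e0 : insert k p a (lift ord0 ord0) = (a ord0).+1 :> nat.
    have [k0|k_gt0] := posnP k.
      by rewrite insert_mid /= /bump; lia.
    have lt1 : 1 < d.+1 by lia.
    by rewrite (@insert_low _ _ _ _ _ _ (Ordinal lt1)) ?(ak (Ordinal lt1)) //= addn1.
  have em : insert k p a (lift ord0 ord_max) = a ord_max.
    by apply: insert_high.
  by apply: (IH _ b _ (fe ord0)) => //=; rewrite ?e0 ?em //; lia.
(* [L] is d consecutive vertices from [a ord0] followed by [a ord_max]. Filling gaps while dropping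
   the next-to-last vertex leads there, since the sum of the entries decreases. *)
have [L fL [Lg Lm]] : exists2 L, dface L &
    (forall i : 'I_d.+1, i < d -> L i = a ord0 + i :> nat) /\ L ord_max = a ord_max.
  have [M] := ubnP (\sum_i a i); move: fa (erefl (a ord0)) (erefl (a ord_max)).
  move: {1 3 5 6}a; elim: M => // M IHM t ft t0 tm ltM; have [inct _] := ft.
  have [tg|[h [h1 [h1E h1d th th1]]]] := first_gap d inct.
    by exists t => //; split=> // i id; rewrite tg // t0.
  have lth : t ord0 + h1 < n by apply: ltn_trans th1 (ltn_ord _).
  have [inch fh] := @gap_subfaces t h h1 (Ordinal lth) ft h1E th erefl th1.
  have [_ t'0 t'm lt_t'] := gap_descent inct inch h1E h1d th1.
  apply: (IHM _ (fh (wide ord_max))); rewrite ?t'0 ?t'm //.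
  exact: leq_trans lt_t' (ltM : _ <= M).
have [incL _] := fL.
have lower b : increasing b -> a ord0 <= b ord0 -> b ord_max < a ord_max -> dface b.
  move=> incb ab0 bam.
  have ltd1 : d.-1 < d.+1 by lia.
  pose j : 'I_d.+1 := Ordinal ltd1.
  have ltq : (a ord_max).-1 < n by have := ltn_ord (a ord_max); lia.
  pose q := Ordinal ltq; pose e' := insert j q L.
  have Lj : L j = a ord0 + d.-1 :> nat by apply: Lg; rewrite /=; lia.
  have ince' : increasing e'.
    apply: insert_increasing => // [|i ji]; first by rewrite Lj /=; lia.
    have -> : i = ord_max by apply: ord_inj; move: ji; have := ltn_ord i; rewrite /=; lia.
    by rewrite Lm /=; lia.
  have e'0 : e' ord0 = a ord0.
    by rewrite /e' (@insert_low _ _ _ _ _ _ ord0) //; apply: ord_inj; rewrite Lg // addn0.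
  (* With q = a_d - 1 inserted into [L], dropping the first vertex gives a face by [upper].
     Exchanging it with [L] yields a face [f] that spans the interval shortened by one from
     above. *)
  pose b' := e' \o lift ord0.
  have b'j : b' j = q by apply: insert_mid.
  have b'm : b' ord_max = a ord_max by rewrite /b' /= -Lm; apply: insert_high => //=; lia.
  have fb' : dface b'.
    apply: upper; rewrite ?b'm //; first exact: increasing_lift.
    by rewrite -e'0; apply: ince'.
  have [|||f ff [fj fm fo]] :=
      @exchange_down K d n Gamma groebner j ord_max L b' _ fL fb'.
  - by rewrite /=; lia.
  - by rewrite b'm.
  - by rewrite b'j Lj /=; lia.
  (* [f j] has its consecutive value, so [f ord0] is at most [a ord0]; all its possible values are
     at least that. *)
  have f0 : f ord0 = a ord0 :> nat.
    have [incf _] := ff; apply/eqP; rewrite eqn_leq; apply/andP; split.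
      have := increasing_add incf (leq0n j : (ord0 : 'I_d.+1) <= j).
      by rewrite fj Lj /=; lia.
    have [j0|j0] := eqVneq j ord0.
      by rewrite -[X in _ <= nat_of_ord (f X)]j0 fj Lj leq_addr.
    have [||->|->] := fo ord0; rewrite ?(eq_sym ord0) -?val_eqE //=.
    - by lia.
    - by rewrite Lg ?leq_addr.
    - by apply: ltnW; rewrite -e'0; apply: ince'.
  by apply: (IH f b) => //; rewrite ?f0 ?fm ?b'j //=; lia.
(* Induction on the sum of the entries, ending at [L]. After a gap of [b] is filled, dropping the
   next-to-last vertex of [b] gives a face by induction and dropping the last one a face by [lower];
   [subfaces] then yields [b]. *)
have sides b : increasing b -> b ord0 = a ord0 -> b ord_max = a ord_max -> dface b.
  have [M] := ubnP (\sum_i b i); elim: M => // M IHM in b *.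
  move=> ltM incb b0 bm.
  have [bg|[h [h1 [h1E h1d bh bh1]]]] := first_gap d incb.
    apply: eq_dface fL => i; have [i_d|d_i] := ltnP i d.
      by apply: ord_inj; rewrite bg // Lg // b0.
    have -> : i = ord_max by apply: ord_inj; move: (ltn_ord i) => /=; lia.
    by rewrite Lm bm.
  have ltq : b ord0 + h1 < n by apply: ltn_trans bh1 (ltn_ord _).
  have incq : increasing (insert h (Ordinal ltq) b).
    apply: insert_increasing => // [|i hi]; first by rewrite bh /=; lia.
    by apply: leq_trans bh1 _; apply: increasing_le => //; lia.
  have [inct t0 tm lt_t] := gap_descent incb incq h1E h1d bh1.
  have ft := IHM _ (leq_trans lt_t (ltM : _ <= M)) inct (etrans t0 b0) (etrans tm bm).
  apply: eq_dface (subfaces (k := ord_max) incq ft _ (lift ord0 h)) => [i|].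
    exact: insert_lift.
  apply: lower; first exact: increasing_lift.
    by rewrite /= (@insert_low _ _ _ _ _ _ ord0) ?b0.
  by rewrite -bm -tm; apply: incq; rewrite /= /bump; lia.
have [ltac|leca] := ltnP (a ord0) (c ord0); first exact: upper.
have [ltca|leac] := ltnP (c ord_max) (a ord_max); first exact: lower.
by apply: sides => //; apply: ord_inj; apply/eqP; rewrite eqn_leq ?a0 ?am ?leca ?leac.
Qed.

End Converse.

(** * The equivalence for strongly-connected complexes *)

Theorem theorem5 (K : fieldType) (d n : nat) (hd : (1 <= d)%N)
    (V : finType) (hn : #|V| = n) (Delta : {set {set V}})
    (hDelta : simplicial_complex Delta) (hdim : has_dim Delta d)
    (hsc : strongly_connected Delta d) :
  unit_interval n d Delta <->
  exists lab : V -> 'I_n,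
    [/\ bijective lab,
        traceable_labeled d (relabel lab Delta)
      & forall le : rel 'X_{1..d.+1 * n},
          term_order le -> diagonal K le ->
          groebner_basis le (@facet_minors K d n (relabel lab Delta))
            (@det_facet_ideal K d n (relabel lab Delta))].

Proof.
split=> [[lab lab_bij ui]|[lab [lab_bij tr gb]]]; exists lab => //.
  split=> // [|le tole diag]; last exact: unit_interval_groebner.
  exact: unit_interval_traceable.
move=> a fa G cardG /subsetP subG; have [c incc cG] := increasing_of_set cardG.
have inG i : c i \in G by rewrite -cG imset_f.
have := subG _ (inG ord0); have := subG _ (inG ord_max); rewrite !inE.
move=> /andP[_ cm] /andP[c0 _]; rewrite -cG.
by case: (interval_full hd tr gb fa incc c0 cm).
Qed.
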